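(* Let $(H,\xi_H)$ be a finite-dimensional monoidal Hom-Hopf algebra with bijective antipode $S$ over a field $k$, and let $G=\mathrm{Aut}_{mHH}(H)\times\mathrm{Aut}_{mHH}(H)$ with multiplication $(\alpha,\beta)*(\gamma,\delta)=(\alpha\gamma,\delta\gamma^{-1}\beta\gamma)$. Then $\mathcal{MHD}(H)=\{\mathcal{MHD}(H)_{(\alpha,\beta)}\}_{(\alpha,\beta)\in G}$ is a (crossed) monoidal Hom-Hopf $T$-coalgebra over $G$ with the following structures, for $(\alpha,\beta),(\gamma,\delta)\in G$, $f\in H^*$, $h\in H$: (1) the component $\mathcal{MHD}(H)_{(\alpha,\beta)}$ is the diagonal crossed Hom-product algebra $H^*\bowtie H(\alpha,\beta)$; (2) the comultiplication $\Delta_{(\alpha,\beta),(\gamma,\delta)}:\mathcal{MHD}(H)_{(\alpha,\beta)*(\gamma,\delta)}\to\mathcal{MHD}(H)_{(\alpha,\beta)}\otimes\mathcal{MHD}(H)_{(\gamma,\delta)}$ is $$\Delta_{(\alpha,\beta),(\gamma,\delta)}(f\bowtie h)=(f_2\bowtie\gamma(h_1))\otimes(f_1\bowtie\gamma^{-1}\beta\gamma(h_2));$$ (3) the counit is $\varepsilon(f\bowtie h)=\varepsilon(h)f(1_H)$; (4) the antipode $S_{(\alpha,\beta)}:\mathcal{MHD}(H)_{(\alpha,\beta)}\to\mathcal{MHD}(H)_{(\alpha,\beta)^{-1}}=\mathcal{MHD}(H)_{(\alpha^{-1},\alpha\beta^{-1}\alpha^{-1})}$ is $$S_{(\alpha,\beta)}(f\bowtie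 h)=(\varepsilon\bowtie\alpha\beta S\xi_H^{-1}(h))\,(S^{*-1}\xi_H^*(f)\bowtie1_H);$$ (5) the conjugation isomorphism $\varphi^{(\alpha,\beta)}_{(\gamma,\delta)}:\mathcal{MHD}(H)_{(\gamma,\delta)}\to\mathcal{MHD}(H)_{(\alpha,\beta)*(\gamma,\delta)*(\alpha,\beta)^{-1}}$ is $$\varphi^{(\alpha,\beta)}_{(\gamma,\delta)}(f\bowtie h)=f\circ\beta\alpha^{-1}\bowtie\alpha\gamma^{-1}\beta^{-1}\gamma(h).$$
   Context: Everything is over a field $k$. Objects of the monoidal Hom-category $\widetilde{\mathcal H}(\mathcal M_k)$ are pairs $(M,\xi_M)$ with $M$ a $k$-vector space and $\xi_M$ a linear automorphism; morphisms are linear maps commuting with the automorphisms; the tensor product is $(M\otimes N,\xi_M\otimes\xi_N)$. A monoidal Hom-algebra $(A,\xi_A)$ has $1_A\in A$ and a bilinear product with $\xi_A(ab)=\xi_A(a)\xi_A(b)$, $\xi_A(1_A)=1_A$, $\xi_A(a)(bc)=(ab)\xi_A(c)$, $a1_A=1_Aa=\xi_A(a)$. A monoidal Hom-coalgebra $(C,\xi_C)$ has $\Delta(c)=c_1\otimes c_2$, $\varepsilon$ with $\Delta\xi_C=(\xi_C\otimes\xi_C)\Delta$, $\varepsilon\xi_C=\varepsilon$, $\xi_C^{-1}(c_1)\otimes\Delta(c_2)=\Delta(c_1)\otimes\xi_C^{-1}(c_2)$, $c_1\varepsilon(c_2)=\xi_C^{-1}(c)=\varepsilon(c_1)c_2$.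 A monoidal Hom-Hopf algebra $(H,\xi_H)$ is both, with $\Delta,\varepsilon$ multiplicative and unital and an antipode $S$ (commuting with $\xi_H$) with $S(h_1)h_2=\varepsilon(h)1_H=h_1S(h_2)$. $\mathrm{Aut}_{mHH}(H)$ is the group of automorphisms of the monoidal Hom-Hopf algebra $H$ (bijective algebra and coalgebra maps commuting with $\xi_H$). The unit of $G$ is $(\mathrm{id},\mathrm{id})$ and $(\alpha,\beta)^{-1}=(\alpha^{-1},\alpha\beta^{-1}\alpha^{-1})$. Write $\xi_H^{*}(f)=f\circ\xi_H$ and $S^*(f)=f\circ S$. The dual $(H^*,\xi_H^{*-1})$ has product $\langle fg,h\rangle=\langle f,h_1\rangle\langle g,h_2\rangle$, unit $\varepsilon$, and coproduct $f_1\otimes f_2$ given by $\langle f_1,h\rangle\langle f_2,l\rangle=\langle f,hl\rangle$. Put $h\rightharpoonup f=\langle f_2,\xi_H^{-1}(h)\rangle\xi_H^{*-2}(f_1)$, $f\leftharpoonup h=\langle f_1,\xi_H^{-1}(h)\rangle\xi_H^{*-2}(f_2)$. The diagonal crossed Hom-product $H^*\bowtie H(\alpha,\beta)$ is the vector space $H^*\otimes H$ with structure automorphism $\xi_H^{*-1}\otimes\xi_H$, unit $\varepsilon\bowtie1_H$, and product $$(f\bowtie h)(g\bowtie l)=f\big(\alpha(h_1)\rightharpoonup(\xi_H^{*2}(g)\leftharpoonup S^{-1}(\beta(h_{22})))\big)\bowtie\xi_H^2(h_{21})\,l .$$ Let $G$ be a group with unit $e$. A monoidal Hom $T$-coalgebra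 over $G$ is a family $\{(C_p,\xi_{C_p})\}_{p\in G}$ of objects of $\widetilde{\mathcal H}(\mathcal M_k)$ with linear maps $\Delta_{p,q}:C_{pq}\to C_p\otimes C_q$, $c\mapsto c_{(1,p)}\otimes c_{(2,q)}$, and $\varepsilon:C_e\to k$, such that $\xi_{C_p}^{-1}(c_{(1,p)})\otimes\Delta_{q,r}(c_{(2,qr)})=\Delta_{p,q}(c_{(1,pq)})\otimes\xi_{C_r}^{-1}(c_{(2,r)})$ for $c\in C_{pqr}$; $c_{(1,p)}\varepsilon(c_{(2,e)})=\varepsilon(c_{(1,e)})c_{(2,p)}=\xi_{C_p}^{-1}(c)$ for $c\in C_p$; $\Delta_{p,q}\xi_{C_{pq}}^{-1}=(\xi_{C_p}^{-1}\otimes\xi_{C_q}^{-1})\Delta_{p,q}$; $\varepsilon\xi_{C_e}^{-1}=\varepsilon$. A monoidal Hom-Hopf $T$-coalgebra over $G$ is a monoidal Hom $T$-coalgebra $\{(H_p,\xi_{H_p})\}$ in which each $H_p$ is a monoidal Hom-algebra with unit $1_p$, all $\Delta_{p,q}$ and $\varepsilon$ are multiplicative and unital, with an antipode consisting of morphisms $S_p:H_p\to H_{p^{-1}}$ of $\widetilde{\mathcal H}(\mathcal M_k)$ with $S_{p^{-1}}(h_{(1,p^{-1})})h_{(2,p)}=\varepsilon(h)1_p=h_{(1,p)}S_{p^{-1}}(h_{(2,p^{-1})})$ for all $h\in H_e$. It is crossed if it is endowed with Hom-algebra isomorphisms (conjugations) $\varphi_q:H_p\to H_{qpq^{-1}}$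 for all $p,q\in G$ such that $\Delta_{rpr^{-1},rqr^{-1}}\varphi_r=(\varphi_r\otimes\varphi_r)\Delta_{p,q}$, $\varepsilon\varphi_r=\varepsilon$, and $\varphi_q\varphi_r=\varphi_{qr}$. Here $\varphi_{(\alpha,\beta)}$ restricted to $\mathcal{MHD}(H)_{(\gamma,\delta)}$ is written $\varphi^{(\alpha,\beta)}_{(\gamma,\delta)}$. *)

(* Defs.v *)
From HB Require Import structures.
From mathcomp Require Import all_boot all_order all_algebra.
From mathcomp Require Import boolp ring.

Set Implicit Arguments.
Unset Strict Implicit.
Unset Printing Implicit Defensive.

Import GRing.Theory.
Local Open Scope ring_scope.

Reserved Notation "u \ox v" (at level 40, left associativity).
Reserved Notation "\sw_ ( a , b <- t ) E"
  (at level 41, E at level 41, a name, b name,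
   format "'[' \sw_ ( a ,  b  <-  t ) '/  '  E ']'").

(* Coordinates in the product of the bases [vbasis {:U}] and [vbasis {:V}];
   [sweedlerE] and [sweedler_uniq] below give the universal property. *)
Definition tens (k : fieldType) (U V : vectType k) : vectType k :=
  'M[k]_(\dim {:U}, \dim {:V}).

Definition ptens (k : fieldType) (U V : vectType k) (u : U) (v : V) :
    tens U V :=
  \matrix_(i, j) (coord (vbasis {:U}) i u * coord (vbasis {:V}) j v).
Notation "u \ox v" := (ptens u v) : ring_scope.

(* Sweedler notation: for [b] bilinear and [t = \sum u_i \ox v_i], this is
   [\sum b u_i v_i], i.e. the value at [t] of the linear map induced by [b].
   It is meaningful only when [b] is bilinear. *)
Definition sweedler (k : fieldType) (U V W : vectType k) (t : tens U V)
    (b : U -> V -> W) : W :=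
  \sum_i \sum_j (t : 'M[k]_(\dim {:U}, \dim {:V})) i j
    *: b (vbasis {:U})`_i (vbasis {:V})`_j.
Notation "\sw_ ( a , b <- t ) E" := (sweedler t (fun a b => E)) : ring_scope.

Definition is_bilinear (k : fieldType) (U V W : lmodType k)
    (b : U -> V -> W) : Prop :=
  (forall u, linear (b u)) /\ (forall v, linear (b^~ v)).

Definition tmap (k : fieldType) (U U' V V' : vectType k)
    (f : U -> U') (g : V -> V') (t : tens U V) : tens U' V' :=
  \sw_(a, b <- t) (f a \ox g b).

Definition tassoc (k : fieldType) (U V W : vectType k)
    (t : tens (tens U V) W) : tens U (tens V W) :=
  \sw_(s, w <- t) \sw_(u, v <- s) (u \ox (v \ox w)).

Definition tmul (k : fieldType) (A B : vectType k)
    (mulA : A -> A -> A) (mulB : B -> B -> B) (t t' : tens A B) : tens A B :=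
  \sw_(a, b <- t) \sw_(a', b' <- t') (mulA a a' \ox mulB b b').

Record hom_algebra (k : fieldType) (A : vectType k) (xi : 'End(A))
    (mul : A -> A -> A) (one : A) : Prop := {
  ha_bij : bijective xi;
  ha_bilinear : is_bilinear mul;
  ha_xiM : forall a b, xi (mul a b) = mul (xi a) (xi b);
  ha_xi1 : xi one = one;
  ha_mulA : forall a b c, mul (xi a) (mul b c) = mul (mul a b) (xi c);
  ha_mul1r : forall a, mul a one = xi a;
  ha_mul1l : forall a, mul one a = xi a
}.

Record hom_coalgebra (k : fieldType) (C : vectType k) (xi : 'End(C))
    (Delta : 'Hom(C, tens C C)) (eps : 'Hom(C, k^o)) : Prop := {
  hc_bij : bijective xi;
  hc_Dxi : forall c, Delta (xi c) = tmap xi xi (Delta c);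
  hc_exi : forall c, eps (xi c) = eps c;
  hc_coassoc : forall c,
    tmap (xi^-1)%VF Delta (Delta c)
    = tassoc (tmap Delta (xi^-1)%VF (Delta c));
  hc_counitr : forall c, \sw_(c1, c2 <- Delta c) (eps c2 *: c1) = (xi^-1)%VF c;
  hc_counitl : forall c, \sw_(c1, c2 <- Delta c) (eps c1 *: c2) = (xi^-1)%VF c
}.

Record hom_hopf_axioms (k : fieldType) (H : vectType k) (xi : 'End(H))
    (mul : H -> H -> H) (one : H) (Delta : 'Hom(H, tens H H))
    (eps : 'Hom(H, k^o)) (S : 'End(H)) : Prop := {
  hh_alg : hom_algebra xi mul one;
  hh_coalg : hom_coalgebra xi Delta eps;
  hh_DM : forall a b, Delta (mul a b) = tmul mul mul (Delta a) (Delta b);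
  hh_D1 : Delta one = one \ox one;
  hh_eM : forall a b, eps (mul a b) = (eps a : k) * eps b;
  hh_e1 : eps one = 1;
  hh_Sxi : forall h, S (xi h) = xi (S h);
  hh_Sl : forall h, \sw_(h1, h2 <- Delta h) mul (S h1) h2 = eps h *: one;
  hh_Sr : forall h, \sw_(h1, h2 <- Delta h) mul h1 (S h2) = eps h *: one
}.

(* Finite-dimensional monoidal Hom-Hopf algebras: [vectType] is
   finite-dimensional. *)
Record homHopf (k : fieldType) := HomHopf {
  hcar :> vectType k;
  hxi : 'End(hcar);
  hmul : hcar -> hcar -> hcar;
  hone : hcar;
  hDelta : 'Hom(hcar, tens hcar hcar);
  heps : 'Hom(hcar, k^o);
  hS : 'End(hcar);
  hopfP : hom_hopf_axioms hxi hmul hone hDelta heps hS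
}.

Arguments hxi {k}.
Arguments hmul {k h}.
Arguments hone {k}.
Arguments hDelta {k}.
Arguments heps {k}.
Arguments hS {k}.

Record hom_algebra_morphism (k : fieldType) (A B : vectType k)
    (xiA : 'End(A)) (mulA : A -> A -> A) (oneA : A)
    (xiB : 'End(B)) (mulB : B -> B -> B) (oneB : B)
    (f : 'Hom(A, B)) : Prop := {
  ham_xi : forall a, f (xiA a) = xiB (f a);
  ham_M : forall a b, f (mulA a b) = mulB (f a) (f b);
  ham_1 : f oneA = oneB
}.

Record hom_coalgebra_morphism (k : fieldType) (C D : vectType k)
    (xiC : 'End(C)) (DeltaC : 'Hom(C, tens C C)) (epsC : 'Hom(C, k^o))
    (xiD : 'End(D)) (DeltaD : 'Hom(D, tens D D)) (epsD : 'Hom(D, k^o))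
    (f : 'Hom(C, D)) : Prop := {
  hcm_xi : forall c, f (xiC c) = xiD (f c);
  hcm_D : forall c, DeltaD (f c) = tmap f f (DeltaC c);
  hcm_e : forall c, epsD (f c) = epsC c
}.

(* [C ((p * q) * r)] and [C (p * (q * r))] are equal but not convertible types,
   so the axioms below transport along equalities of the group. *)
Definition gcast (k : fieldType) (G : groupType) (C : G -> vectType k)
    (p q : G) (e : p = q) (c : C p) : C q :=
  eq_rect p (fun r => C r) c q e.

Record hom_Tcoalgebra (k : fieldType) (G : groupType) (C : G -> vectType k)
    (xi : forall p, 'End(C p))
    (Delta : forall p q, 'Hom(C (p * q)%g, tens (C p) (C q)))
    (eps : 'Hom(C 1%g, k^o)) : Prop := {
  htc_bij : forall p, bijective (xi p);
  htc_coassoc : forall p q r (c : C (p * (q * r))%g),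
    tmap (xi p)^-1%VF (Delta q r) (Delta p (q * r)%g c)
    = tassoc (tmap (Delta p q) (xi r)^-1%VF
                (Delta (p * q)%g r (gcast (mulgA p q r) c)));
  htc_counitr : forall p (c : C p),
    \sw_(c1, c2 <- Delta p 1%g (gcast (esym (mulg1 p)) c)) (eps c2 *: c1)
    = (xi p)^-1%VF c;
  htc_counitl : forall p (c : C p),
    \sw_(c1, c2 <- Delta 1%g p (gcast (esym (mul1g p)) c)) (eps c1 *: c2)
    = (xi p)^-1%VF c;
  htc_Dxi : forall p q c,
    Delta p q ((xi (p * q)%g)^-1%VF c)
    = tmap (xi p)^-1%VF (xi q)^-1%VF (Delta p q c);
  htc_exi : forall c, eps ((xi 1%g)^-1%VF c) = eps c
}.

Record hom_hopf_Tcoalgebra (k : fieldType) (G : groupType)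
    (C : G -> vectType k) (xi : forall p, 'End(C p))
    (mul : forall p, C p -> C p -> C p) (one : forall p, C p)
    (Delta : forall p q, 'Hom(C (p * q)%g, tens (C p) (C q)))
    (eps : 'Hom(C 1%g, k^o))
    (S : forall p, 'Hom(C p, C p^-1%g)) : Prop := {
  hht_coalg : hom_Tcoalgebra xi Delta eps;
  hht_alg : forall p, hom_algebra (xi p) (mul p) (one p);
  hht_DM : forall p q a b,
    Delta p q (mul (p * q)%g a b)
    = tmul (mul p) (mul q) (Delta p q a) (Delta p q b);
  hht_D1 : forall p q, Delta p q (one (p * q)%g) = one p \ox one q;
  hht_eM : forall a b, eps (mul 1%g a b) = (eps a : k) * eps b;
  hht_e1 : eps (one 1%g) = 1;
  hht_Sxi : forall p c, S p (xi p c) = xi p^-1%g (S p c);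
  hht_Sl : forall p (h : C 1%g),
    \sw_(h1, h2 <- Delta p^-1%g p (gcast (esym (mulVg p)) h))
       mul p (gcast (invgK p) (S p^-1%g h1)) h2
    = eps h *: one p;
  hht_Sr : forall p (h : C 1%g),
    \sw_(h1, h2 <- Delta p p^-1%g (gcast (esym (mulgV p)) h))
       mul p h1 (gcast (invgK p) (S p^-1%g h2))
    = eps h *: one p
}.

Lemma conjMg_eq (G : groupType) (r p q : G) :
  (r * (p * q) * r^-1 = (r * p * r^-1) * (r * q * r^-1))%g.
Proof. by rewrite !mulgA mulgVK. Qed.

Lemma conj1g_eq (G : groupType) (r : G) : (r * 1 * r^-1 = 1)%g.
Proof. by rewrite mulg1 mulgV. Qed.

Lemma conjgM_eq (G : groupType) (q r p : G) :
  (q * (r * p * r^-1) * q^-1 = (q * r) * p * (q * r)^-1)%g.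
Proof. by rewrite invgM !mulgA. Qed.

Record crossed_hom_hopf_Tcoalgebra (k : fieldType) (G : groupType)
    (C : G -> vectType k) (xi : forall p, 'End(C p))
    (mul : forall p, C p -> C p -> C p) (one : forall p, C p)
    (Delta : forall p q, 'Hom(C (p * q)%g, tens (C p) (C q)))
    (eps : 'Hom(C 1%g, k^o))
    (S : forall p, 'Hom(C p, C p^-1%g))
    (phi : forall q p, 'Hom(C p, C (q * p * q^-1)%g)) : Prop := {
  cht_hopf : hom_hopf_Tcoalgebra xi mul one Delta eps S;
  cht_bij : forall q p, bijective (phi q p);
  cht_morph : forall q p,
    hom_algebra_morphism (xi p) (mul p) (one p)
      (xi (q * p * q^-1)%g) (mul (q * p * q^-1)%g) (one (q * p * q^-1)%g)
      (phi q p);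
  cht_D : forall r p q (c : C (p * q)%g),
    Delta (r * p * r^-1)%g (r * q * r^-1)%g
      (gcast (conjMg_eq r p q) (phi r (p * q)%g c))
    = tmap (phi r p) (phi r q) (Delta p q c);
  cht_e : forall r (c : C 1%g), eps (gcast (conj1g_eq r) (phi r 1%g c)) = eps c;
  cht_comp : forall q r p (c : C p),
    gcast (conjgM_eq q r p) (phi q (r * p * r^-1)%g (phi r p c))
    = phi (q * r)%g p c
}.

Definition is_hopf_aut (k : fieldType) (H : homHopf k) (f : 'End(H)) : Prop :=
  [/\ bijective f,
      hom_algebra_morphism (hxi H) hmul (hone H) (hxi H) hmul (hone H) f &
      hom_coalgebra_morphism (hxi H) (hDelta H) (heps H)
        (hxi H) (hDelta H) (heps H) f].

(* [asbool] turns membership into a boolean, so that the automorphisms form a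
   subtype of the endomorphisms and hence a [choiceType], as [groupType]
   requires. The group law is composition. *)
Record hopfAut (k : fieldType) (H : homHopf k) := HopfAut {
  hopfAut_val :> 'End(H);
  hopfAut_valP : `[< is_hopf_aut hopfAut_val >]
}.

HB.instance Definition _ (k : fieldType) (H : homHopf k) :=
  [isSub for @hopfAut_val k H].
HB.instance Definition _ (k : fieldType) (H : homHopf k) :=
  [Choice of hopfAut H by <:].

Section SweedlerTheory.
Variable k : fieldType.
Implicit Types U V W : vectType k.

Lemma sweedler_linear U V W (b : U -> V -> W) :
  linear (fun t : tens U V => sweedler t b).
Proof.
move=> a s t; rewrite /sweedler scaler_sumr -big_split /=.
apply: eq_bigr => i _; rewrite scaler_sumr -big_split /=.
by apply: eq_bigr => j _; rewrite !mxE scalerDl scalerA.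
Qed.

Lemma linear_sumE U W (f : U -> W) (lf : linear f) I (r : seq I) (c : I -> k)
  (u : I -> U) : f (\sum_(i <- r) c i *: u i) = \sum_(i <- r) c i *: f (u i).
Proof.
have f0 : f 0 = 0 by have := lf (-1) 0 0; rewrite scaler0 addr0 scaleN1r addNr.
by elim/big_rec2: _ => // i y1 y2 _ <-; rewrite lf.
Qed.

Lemma vect_coord U (u : U) :
  u = \sum_i coord (vbasis {:U}) i u *: (vbasis {:U})`_i.
Proof. by apply: coord_vbasis; apply: memvf. Qed.

Lemma sweedlerE U V W (b : U -> V -> W) u v :
  is_bilinear b -> sweedler (u \ox v) b = b u v.
Proof.
move=> [br bl]; rewrite {2}[u]vect_coord (linear_sumE (bl _)).
apply: eq_bigr => i _; rewrite {2}[v]vect_coord (linear_sumE (br _)) scaler_sumr.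
by apply: eq_bigr => j _; rewrite scalerA mxE.
Qed.

Lemma ptens_bilinear U V : is_bilinear (@ptens k U V).
Proof.
split=> [u|v] a x y; apply/matrixP => i j; rewrite !mxE linearP /=.
  by rewrite mulrDr mulrCA.
by rewrite mulrDl mulrA.
Qed.

Lemma sweedler_ptens U V (t : tens U V) : \sw_(a, b <- t) (a \ox b) = t.
Proof.
rewrite [RHS]matrix_sum_delta; apply: eq_bigr => i _; apply: eq_bigr => j _.
congr (_ *: _); apply/matrixP => i' j'; rewrite !mxE.
by rewrite !coord_free ?(basis_free (vbasisP _)) // -natrM mulnb !(eq_sym i', eq_sym j').
Qed.

Lemma sweedler_uniq U V W (F : tens U V -> W) :
  linear F -> forall t, F t = \sw_(a, b <- t) F (a \ox b).
Proof.
move=> lF t; rewrite -{1}[t]sweedler_ptens /sweedler.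
rewrite pair_bigA (linear_sumE lF) /=.
by rewrite pair_bigA.
Qed.

Lemma linfunP U W (f : U -> W) : linear f -> linfun f =1 f.
Proof.
move=> lf x.
pose fl := GRing.isLinear.Build k U W *:%R f lf.
pose F : {linear U -> W} := HB.pack f fl.
exact: (lfunE F).
Qed.

Lemma is_bilinear_comp U V U' V' W (b : U' -> V' -> W)
    (f : 'Hom(U, U')) (g : 'Hom(V, V')) :
  is_bilinear b -> is_bilinear (fun u v => b (f u) (g v)).
Proof.
by move=> [br bl]; split=> [u|v] a x y /=; rewrite linearP ?br ?bl //; apply: bl.
Qed.

Lemma tmapE U U' V V' (f : 'Hom(U, U')) (g : 'Hom(V, V')) u v :
  tmap f g (u \ox v) = f u \ox g v.
Proof.
rewrite /tmap sweedlerE //; exact: is_bilinear_comp (ptens_bilinear _ _).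
Qed.

Lemma tens_ext U V W (F F' : tens U V -> W) :
  linear F -> linear F' -> (forall u v, F (u \ox v) = F' (u \ox v)) -> F =1 F'.
Proof.
move=> lF lF' e t; rewrite (sweedler_uniq lF) (sweedler_uniq lF').
by apply: eq_bigr => i _; apply: eq_bigr => j _; rewrite e.
Qed.

Lemma tmap_linear U U' V V' (f : U -> U') (g : V -> V') : linear (tmap f g).
Proof. exact: sweedler_linear. Qed.

End SweedlerTheory.

Section LfunInv.
Variables (k : fieldType) (U V : vectType k) (f : 'Hom(U, V)).
Hypothesis bf : bijective f.

Lemma bij_lkerf : lker f == 0%VS.
Proof. by apply/lker0P; apply: bij_inj. Qed.

Lemma lfun_invK x : (f^-1)%VF (f x) = x.
Proof. exact: lker0_lfunK bij_lkerf x. Qed.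

Lemma lfunK_inv y : f ((f^-1)%VF y) = y.
Proof. by case: bf => g gK Kg; rewrite -{1}[y]Kg lfun_invK Kg. Qed.

End LfunInv.

Section AutGroup.
Variables (k : fieldType) (H : homHopf k).
Implicit Types a b c : hopfAut H.

Lemma hopfAutP a : is_hopf_aut a.
Proof. by case: a => f pf; apply/asboolP. Qed.

Lemma hopfAut_bij a : bijective a. Proof. by have [] := hopfAutP a. Qed.

Lemma id_is_aut : is_hopf_aut (\1%VF : 'End(H)).
Proof.
split.
- by exists id => x; rewrite id_lfunE.
- by split=> *; rewrite !id_lfunE.
- split=> c; rewrite ?id_lfunE //.
  rewrite -{1}[hDelta H c]sweedler_ptens.
  by apply: eq_bigr => i _; apply: eq_bigr => j _; rewrite !id_lfunE.
Qed.

Lemma comp_is_aut a b : is_hopf_aut (hopfAut_val a \o hopfAut_val b)%VF.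
Proof.
have [ba ma ca] := hopfAutP a; have [bb mb cb] := hopfAutP b; split.
- apply: (eq_bij (bij_comp ba bb)) => x; by rewrite comp_lfunE.
- split=> *; rewrite !comp_lfunE.
  + by rewrite (ham_xi mb) (ham_xi ma).
  + by rewrite (ham_M mb) (ham_M ma).
  + by rewrite (ham_1 mb) (ham_1 ma).
- split=> c; rewrite ?comp_lfunE.
  + by rewrite (hcm_xi cb) (hcm_xi ca).
  + rewrite (hcm_D ca) (hcm_D cb); move: (hDelta H c).
    apply: tens_ext; try exact: tmap_linear.
      by move=> d s t; rewrite !tmap_linear.
    by move=> u v; rewrite !tmapE !comp_lfunE.
  + by rewrite (hcm_e ca) (hcm_e cb).
Qed.

Lemma inv_is_aut a : is_hopf_aut ((hopfAut_val a)^-1)%VF.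
Proof.
have [ba ma ca] := hopfAutP a.
have K := lfun_invK ba; have K' := lfunK_inv ba.
split.
- by exists a => x.
- split=> *; apply: (bij_inj ba); rewrite K'.
  + by rewrite (ham_xi ma) K'.
  + by rewrite (ham_M ma) !K'.
  + by rewrite (ham_1 ma).
- split=> c; first by apply: (bij_inj ba); rewrite (hcm_xi ca) !K'.
  + rewrite -{2}[c]K' (hcm_D ca) -[LHS]sweedler_ptens.
    move: (hDelta H _); apply: tens_ext; first exact: sweedler_linear.
      by move=> d s t; rewrite !tmap_linear.
    by move=> u v; rewrite sweedler_ptens !tmapE !K.
  + by rewrite -{2}[c]K' (hcm_e ca).
Qed.

Definition hopfAut_one : hopfAut H := HopfAut (asboolT id_is_aut).
Definition hopfAut_mul a b : hopfAut H := HopfAut (asboolT (comp_is_aut a b)).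
Definition hopfAut_inv a : hopfAut H := HopfAut (asboolT (inv_is_aut a)).

Lemma hopfAut_mulA : associative hopfAut_mul.
Proof. by move=> a b c; apply: val_inj; rewrite /= comp_lfunA. Qed.
Lemma hopfAut_mul1 : left_id hopfAut_one hopfAut_mul.
Proof. by move=> a; apply: val_inj; rewrite /= comp_lfun1l. Qed.
Lemma hopfAut_mulr1 : right_id hopfAut_one hopfAut_mul.
Proof. by move=> a; apply: val_inj; rewrite /= comp_lfun1r. Qed.
Lemma hopfAut_mulV : left_inverse hopfAut_one hopfAut_inv hopfAut_mul.
Proof.
move=> a; apply: val_inj; apply/lfunP => x.
by rewrite /= comp_lfunE id_lfunE (lfun_invK (hopfAut_bij a)).
Qed.
Lemma hopfAut_mulrV : right_inverse hopfAut_one hopfAut_inv hopfAut_mul.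
Proof.
move=> a; apply: val_inj; apply/lfunP => x.
by rewrite /= comp_lfunE id_lfunE (lfunK_inv (hopfAut_bij a)).
Qed.

HB.instance Definition _ := isGroup.Build (hopfAut H)
  hopfAut_mulA hopfAut_mul1 hopfAut_mulr1 hopfAut_mulV hopfAut_mulrV.

(* Not the direct product: the law is
   (alpha, beta) * (gamma, delta)
     = (alpha gamma, delta gamma^-1 beta gamma). *)
Definition mhdG : Type := hopfAut H * hopfAut H.
HB.instance Definition _ := Choice.copy mhdG (hopfAut H * hopfAut H)%type.

Definition mhdG_mul (p q : mhdG) : mhdG :=
  (p.1 * q.1, q.2 * q.1^-1 * p.2 * q.1)%g.
Definition mhdG_one : mhdG := (1, 1)%g.
Definition mhdG_inv (p : mhdG) : mhdG := (p.1^-1, p.1 * p.2^-1 * p.1^-1)%g.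

Lemma mhdG_mulA : associative mhdG_mul.
Proof.
by move=> [a b] [c d] [m n]; rewrite /mhdG_mul /= invgM !mulgA !mulgK.
Qed.
Lemma mhdG_mul1 : left_id mhdG_one mhdG_mul.
Proof. by move=> [a b]; rewrite /mhdG_mul /= mul1g mulg1 mulgVK. Qed.
Lemma mhdG_mulr1 : right_id mhdG_one mhdG_mul.
Proof. by move=> [a b]; rewrite /mhdG_mul /= !mulg1 invg1 !mul1g. Qed.
Lemma mhdG_mulV : left_inverse mhdG_one mhdG_inv mhdG_mul.
Proof.
by move=> [a b]; rewrite /mhdG_mul /mhdG_inv /= !mulgA mulVg !(mulgVK, mulgV, mulVg).
Qed.
Lemma mhdG_mulrV : right_inverse mhdG_one mhdG_inv mhdG_mul.
Proof.
move=> [a b]; rewrite /mhdG_mul /mhdG_inv /= invgK mulgV.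
by rewrite !(mulgVK, mulgV).
Qed.

HB.instance Definition _ := isGroup.Build mhdG
  mhdG_mulA mhdG_mul1 mhdG_mulr1 mhdG_mulV mhdG_mulrV.

End AutGroup.

Section MHD.
Variables (k : fieldType) (H : homHopf k).

Notation dual := 'Hom(hcar H, k^o).

(* The canonical map from [H^* \ox H^*] to [(H \ox H)^*]; it is onto since [H]
   is finite-dimensional, see [dual_comulP] and [dual_comul_uniq]. *)
Definition dual_pair : 'Hom(tens dual dual, 'Hom(tens H H, k^o)) :=
  linfun (fun t : tens dual dual => linfun (fun s : tens H H =>
    \sw_(f1, f2 <- t) \sw_(h1, h2 <- s) (f1 h1 * f2 h2 : k^o))).

Definition dual_comul (f : dual) : tens dual dual :=
  (dual_pair^-1)%VF (linfun (fun s : tens H H => \sw_(h, l <- s) f (hmul h l))).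

Definition dual_mul (f g : dual) : dual :=
  linfun (fun h => \sw_(h1, h2 <- hDelta H h) (f h1 * g h2 : k^o)).

Definition dual_map (u : 'End(H)) : 'End(dual) :=
  linfun (fun f : dual => (f \o u)%VF).

(* [dual_xi] and [dual_S] are the transposes [xi^*] and [S^*]; the structure
   automorphism of [H^*] is the inverse of [dual_xi]. *)
Definition dual_xi : 'End(dual) := dual_map (hxi H).
Definition dual_S : 'End(dual) := dual_map (hS H).

(* [lhit h f] is h \rightharpoonup f and [rhit f h] is f \leftharpoonup h. *)
Definition lhit (h : H) (f : dual) : dual :=
  \sw_(f1, f2 <- dual_comul f)
    ((f2 ((hxi H)^-1%VF h) : k) *: dual_xi^-1%VF (dual_xi^-1%VF f1)).

Definition rhit (f : dual) (h : H) : dual :=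
  \sw_(f1, f2 <- dual_comul f)
    ((f1 ((hxi H)^-1%VF h) : k) *: dual_xi^-1%VF (dual_xi^-1%VF f2)).

(* The pure tensor [f \ox h] is the element f \bowtie h; [MHD_xiE] to
   [MHD_phiE] below give the values of the maps on pure tensors. *)
Definition MHD (p : mhdG H) : vectType k := tens dual H.

Definition MHD_xi (p : mhdG H) : 'End(MHD p) :=
  linfun (tmap dual_xi^-1%VF (hxi H)).

Definition MHD_one (p : mhdG H) : MHD p := heps H \ox hone H.

Definition MHD_mul (p : mhdG H) (x y : MHD p) : MHD p :=
  \sw_(f, h <- x) \sw_(g, l <- y)
  \sw_(h1, h2 <- hDelta H h) \sw_(h21, h22 <- hDelta H h2)
    (dual_mul f
       (lhit (p.1 h1) (rhit (dual_xi (dual_xi g)) ((hS H)^-1%VF (p.2 h22))))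
     \ox hmul (hxi H (hxi H h21)) l).

Definition MHD_Delta (p q : mhdG H) :
    'Hom(MHD (p * q)%g, tens (MHD p) (MHD q)) :=
  linfun (fun x : MHD (p * q)%g =>
    \sw_(f, h <- x) \sw_(f1, f2 <- dual_comul f) \sw_(h1, h2 <- hDelta H h)
      (((f2 \ox q.1 h1) : MHD p)
       \ox ((f1 \ox (q.1^-1 * p.2 * q.1)%g h2) : MHD q))).

Definition MHD_eps : 'Hom(MHD 1%g, k^o) :=
  linfun (fun x : MHD 1%g =>
    \sw_(f, h <- x) (heps H h * f (hone H) : k^o)).

Definition MHD_S (p : mhdG H) : 'Hom(MHD p, MHD p^-1%g) :=
  linfun (fun x : MHD p =>
    \sw_(f, h <- x)
      MHD_mul (p := p^-1%g)
        (heps H \ox (p.1 * p.2)%g (hS H ((hxi H)^-1%VF h)))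
        (dual_S^-1%VF (dual_xi f) \ox hone H)).

Definition MHD_phi (q p : mhdG H) : 'Hom(MHD p, MHD (q * p * q^-1)%g) :=
  linfun (fun x : MHD p =>
    \sw_(f, h <- x)
      ((f \o hopfAut_val (q.2 * q.1^-1)%g)%VF
       \ox (q.1 * p.1^-1 * q.2^-1 * p.1)%g h)).

Lemma sweedler_linearr (U V W X : vectType k) (t : tens U V)
    (F : U -> V -> X -> W) :
  (forall u v, linear (F u v)) -> linear (fun x => \sw_(u, v <- t) F u v x).
Proof.
move=> lF a x y; rewrite /sweedler scaler_sumr -big_split /=.
apply: eq_bigr => i _; rewrite scaler_sumr -big_split /=.
by apply: eq_bigr => j _; rewrite lF scalerDr !scalerA mulrC.
Qed.

Lemma hmul_bilinear : is_bilinear (@hmul k H).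
Proof. exact: (ha_bilinear (hh_alg (hopfP H))). Qed.

Lemma lfun_mul_bilinear (f g : dual) :
  is_bilinear (fun h1 h2 : H => f h1 * g h2 : k^o).
Proof.
split=> [u|v] a x y; rewrite linearP /=.
  by rewrite mulrDr; congr (_ + _); rewrite mulrCA.
by rewrite mulrDl; congr (_ + _); rewrite -mulrA.
Qed.

Lemma dual_pair_lin (t : tens dual dual) : linear (fun s : tens H H =>
  \sw_(f1, f2 <- t) \sw_(h1, h2 <- s) (f1 h1 * f2 h2 : k^o)).
Proof. by apply: sweedler_linearr => f1 f2; apply: sweedler_linear. Qed.

Lemma dual_pairE t h l :
  dual_pair t (h \ox l) = \sw_(f1, f2 <- t) (f1 h * f2 l : k^o).
Proof.
rewrite /dual_pair linfunP => [|a x y].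
  rewrite linfunP; last exact: dual_pair_lin.
  apply: eq_bigr => i _; apply: eq_bigr => j _.
  by rewrite sweedlerE //; apply: lfun_mul_bilinear.
apply/lfunP => s; rewrite !lfunE /= !lfunE /= !(linfunP (dual_pair_lin _)).
exact: sweedler_linear.
Qed.

Definition dual_basis (i : 'I_(\dim {:hcar H})) : dual :=
  linfun (coord (vbasis {:H}) i : H -> k^o).

Lemma dual_basisE i (h : H) : dual_basis i h = coord (vbasis {:H}) i h.
Proof. by rewrite linfunP // => a x y; rewrite linearP. Qed.

Lemma dual_comulP f h l :
  \sw_(f1, f2 <- dual_comul f) (f1 h * f2 l : k^o) = f (hmul h l).
Proof.
have lf : linear (fun s : tens H H => \sw_(h, l <- s) f (hmul h l)).
  exact: sweedler_linear.
set phi := linfun (fun s : tens H H => \sw_(h, l <- s) f (hmul h l)).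
suff im : phi \in limg dual_pair.
  rewrite -dual_pairE /dual_comul -/phi limg_lfunVK // linfunP // sweedlerE //.
  have [br bl] := hmul_bilinear.
  by split=> u a x y; rewrite ?br ?bl linearP.
pose b := vbasis {:H}.
pose t : tens dual dual :=
  \sum_(i < \dim {:hcar H}) \sum_(j < \dim {:hcar H}) phi (b`_i \ox b`_j) *: (dual_basis i \ox dual_basis j).
suff -> : phi = dual_pair t by apply: memv_img; apply: memvf.
apply/lfunP; apply: tens_ext => [||u v]; try exact: linearP.
rewrite /t !linear_sum sum_lfunE.
rewrite [u in LHS]vect_coord (linear_sumE (proj2 (ptens_bilinear _ _) _)).
rewrite linear_sum; apply: eq_bigr => i _.
rewrite linear_sum sum_lfunE [v in LHS]vect_coord.
rewrite (linear_sumE (proj1 (ptens_bilinear _ _) _)) scaler_sumr linear_sum.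
apply: eq_bigr => j _; rewrite !linearZ /= scale_lfunE dual_pairE.
rewrite sweedlerE; last first.
  split=> w a x y; rewrite lfunE /= lfunE /=.
    by rewrite mulrDr; congr (_ + _); rewrite mulrCA.
  by rewrite mulrDl; congr (_ + _); rewrite -mulrA.
rewrite !dual_basisE /GRing.scale /=; ring.
Qed.

Lemma dual_comul_uniq (f : dual) (t : tens dual dual) :
  (forall h l, \sw_(f1, f2 <- t) (f1 h * f2 l : k^o) = f (hmul h l)) ->
  t = dual_comul f.
Proof.
move=> ht; apply/eqP; rewrite -subr_eq0; apply/eqP.
set d := t - _.
have d0 h l : \sw_(f1, f2 <- d) (f1 h * f2 l : k^o) = 0.
  have -> : d = (-1) *: dual_comul f + t by rewrite scaleN1r addrC.
  by rewrite (sweedler_linear _ (-1)) ht dual_comulP scaleN1r addNr.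
have /freeP fr := basis_free (vbasisP {:dual}).
have e l i : \sum_j (d : 'M_(_, _)) i j *: ((vbasis {:dual})`_j l : k^o) = 0 :> k^o.
  pose c i := \sum_j (d : 'M_(_, _)) i j *: ((vbasis {:dual})`_j l : k^o).
  suff /fr : \sum_i c i *: (vbasis {:dual})`_i = 0 by apply.
  apply/lfunP => h; rewrite sum_lfunE zero_lfunE -[RHS](d0 h l).
  apply: eq_bigr => i' _; rewrite scale_lfunE /c scaler_suml.
  apply: eq_bigr => j _; rewrite /GRing.scale /=; ring.
apply/matrixP => i j; rewrite [RHS]mxE.
apply: (fr (fun j => (d : 'M_(_, _)) i j)); apply/lfunP => l.
rewrite sum_lfunE zero_lfunE -[RHS](e l i).
by apply: eq_bigr => j' _; rewrite scale_lfunE.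
Qed.

Lemma dual_comul_linear : linear dual_comul.
Proof.
move=> a f g; rewrite /dual_comul -linearP; congr (_ _).
have lf (u : dual) :
  linear (fun s : tens H H => \sw_(h, l <- s) u (hmul h l)).
  exact: sweedler_linear.
apply/lfunP => s; rewrite lfunE /= lfunE /= !(linfunP (lf _)).
rewrite [in RHS]/sweedler scaler_sumr -big_split /=; apply: eq_bigr => i _.
rewrite scaler_sumr -big_split /=; apply: eq_bigr => j _.
by rewrite lfunE /= lfunE /= scalerDr !scalerA mulrC.
Qed.

Lemma sweedler_comp_linear (U V V' W : vectType k) (D : U -> tens V V')
    (b : V -> V' -> W) :
  linear D -> linear (fun u => \sw_(v, v' <- D u) b v v').
Proof. by move=> lD a x y; rewrite lD sweedler_linear. Qed.

Lemma dual_mapE u (f : dual) h : dual_map u f h = f (u h).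
Proof.
rewrite linfunP ?comp_lfunE // => a x y; apply/lfunP => z.
by rewrite comp_lfunE !lfunE /= !lfunE /= !comp_lfunE.
Qed.

Lemma dual_mulE (f g : dual) h :
  dual_mul f g h = \sw_(h1, h2 <- hDelta H h) (f h1 * g h2 : k^o).
Proof. by rewrite linfunP //; apply: sweedler_comp_linear; apply: linearP. Qed.

Lemma dual_mul_bilinear : is_bilinear dual_mul.
Proof.
split=> [f|g] a x y; apply/lfunP => h;
  rewrite lfunE /= lfunE /= !dual_mulE [in RHS]/sweedler scaler_sumr;
  rewrite -big_split /=; apply: eq_bigr => i _;
  rewrite scaler_sumr -big_split /=; apply: eq_bigr => j _;
  rewrite lfunE /= lfunE /= /GRing.scale /=; ring.
Qed.

Lemma lhit_linear h : linear (lhit h).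
Proof. by apply: sweedler_comp_linear; apply: dual_comul_linear. Qed.

Lemma rhit_linear h : linear (rhit^~ h).
Proof. by apply: sweedler_comp_linear; apply: dual_comul_linear. Qed.

Lemma MHD_xiE p f h :
  MHD_xi p (f \ox h) = (dual_xi^-1%VF f \ox hxi H h).
Proof. by rewrite linfunP ?tmapE //; apply: tmap_linear. Qed.

Lemma MHD_mulE p f h g l :
  MHD_mul (p := p) (f \ox h) (g \ox l)
  = \sw_(h1, h2 <- hDelta H h) \sw_(h21, h22 <- hDelta H h2)
      (dual_mul f
         (lhit (p.1 h1) (rhit (dual_xi (dual_xi g)) ((hS H)^-1%VF (p.2 h22))))
       \ox hmul (hxi H (hxi H h21)) l).
Proof.
rewrite /MHD_mul sweedlerE.
  rewrite sweedlerE //; split=> [g' | l'].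
    do 2!apply: sweedler_linearr => ? ?; move=> a x y.
    by rewrite (proj1 hmul_bilinear) (proj1 (ptens_bilinear _ _)).
  do 2!apply: sweedler_linearr => ? ?; move=> a x y.
  rewrite !linearP rhit_linear lhit_linear (proj1 dual_mul_bilinear).
  by rewrite (proj2 (ptens_bilinear _ _)).
split=> [f' | h'].
  apply: sweedler_linearr => ? ?; apply: sweedler_comp_linear; exact: linearP.
do 3!apply: sweedler_linearr => ? ?.
move=> a x y; rewrite (proj2 dual_mul_bilinear).
by rewrite (proj2 (ptens_bilinear _ _)).
Qed.

Lemma MHD_mul_linearr p x : linear (MHD_mul (p := p) x).
Proof. by apply: sweedler_linearr => ? ?; apply: sweedler_linear. Qed.

Lemma MHD_mul_linearl p y : linear ((@MHD_mul p)^~ y).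
Proof. exact: sweedler_linear. Qed.

Lemma MHD_DeltaE p q f h :
  MHD_Delta p q (f \ox h)
  = \sw_(f1, f2 <- dual_comul f) \sw_(h1, h2 <- hDelta H h)
      (((f2 \ox q.1 h1) : MHD p)
       \ox ((f1 \ox (q.1^-1 * p.2 * q.1)%g h2) : MHD q)).
Proof.
rewrite /MHD_Delta linfunP; last exact: sweedler_linear.
rewrite sweedlerE //; split=> [f'|h'].
  apply: sweedler_linearr => ? ?; apply: sweedler_comp_linear; exact: linearP.
by apply: sweedler_comp_linear; apply: dual_comul_linear.
Qed.

Lemma MHD_epsE f h : MHD_eps (f \ox h) = heps H h * f (hone H).
Proof.
rewrite /MHD_eps linfunP; last exact: sweedler_linear.
rewrite sweedlerE //; split=> u a x y; rewrite ?linearP ?lfunE /= ?lfunE /=;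
  rewrite /GRing.scale /=; ring.
Qed.

Lemma MHD_SE p f h :
  MHD_S p (f \ox h)
  = MHD_mul (p := p^-1%g)
      (heps H \ox (p.1 * p.2)%g (hS H ((hxi H)^-1%VF h)))
      (dual_S^-1%VF (dual_xi f) \ox hone H).
Proof.
rewrite /MHD_S linfunP; last exact: sweedler_linear.
rewrite sweedlerE //; split=> u a x y.
  by rewrite !linearP (proj1 (ptens_bilinear _ _)) MHD_mul_linearl.
by rewrite !linearP (proj2 (ptens_bilinear _ _)) MHD_mul_linearr.
Qed.

Lemma MHD_phiE q p f h :
  MHD_phi q p (f \ox h)
  = ((f \o hopfAut_val (q.2 * q.1^-1)%g)%VF
     \ox (q.1 * p.1^-1 * q.2^-1 * p.1)%g h).
Proof.
rewrite /MHD_phi linfunP; last exact: sweedler_linear.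
rewrite sweedlerE //; split=> u a x y.
  by rewrite !linearP (proj1 (ptens_bilinear _ _)).
rewrite -(proj2 (ptens_bilinear _ _)); congr (_ \ox _); apply/lfunP => z.
by rewrite comp_lfunE !lfunE /= !lfunE /= !comp_lfunE.
Qed.

End MHD.

(* Main.v *)
Require Import Defs.
From HB Require Import structures.
From mathcomp Require Import all_boot all_order all_algebra.
From mathcomp Require Import boolp.

(** Untwisting. Replace the product of [H] by [a ** b = xi^-1 (a b)] and
    its coproduct by [(xi \ox xi) \o Delta]. The twists in the Hom-axioms
    cancel: what remains is an ordinary Hopf algebra with the same unit,
    counit and antipode, of which [xi] and all the automorphisms in [G] are
    automorphisms, [xi] being central among them. In these terms the
    product of [H^* \bowtie H(alpha, beta)] is the structure automorphism
    applied to the ordinary diagonal crossed product [f (alpha(h1) . g .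
    S^-1 beta(h3)) \bowtie h2 l], where [(a . g . b)(x) = g (b x a)], and
    the other structure maps untwist in the same way.

    Removing the dual. The map sending [f \bowtie h] to the endomorphism [x
    |-> f(x) h] of [H] is injective, so that elements of [H^* \ox H] may be
    handled as endomorphisms [F] ([endo], [eval_at_inj]). The coproduct of
    [H^*] then disappears, because [f1(x) f2(y) = f(xy)]. The product
    becomes [(F G)(x) = u2 G(S^-1 beta(u3) x2 alpha(u1))] with [u = F(x1)]
    ([crossed_mul], [endo_mul]); the comultiplication takes [F] to [(gamma
    \ox B) (Delta (F(y x)))] at the pair [(x, y)], where [B = gamma^-1 beta
    gamma] ([eval_Delta]); the counit is [eps (F 1)]; a conjugation is [F
    |-> sigma F tau] for two automorphisms ([endo_phi]). Each axiom that
    does not involve the antipode turns into an identity between iterated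
    Sweedler sums in [H] alone, for arbitrary linear [F] and [G].

    The identities. Associativity rests on the product of an element [u] of
    [H] with an endomorphism ([cross]): it is multiplicative in [u]
    ([cross_umul]) and compatible with the crossed product
    ([cross_crossed_mul]). When the comultiplication is applied to a
    product, the two legs produce between them a factor [gamma B (h4) S^-1
    (beta gamma (h3))], which collapses because [gamma B = beta gamma]
    ([uDelta_crossed_mul]). For the antipode, associativity separates a
    product of functionals from a product in [H], and each of them
    collapses by an antipode axiom ([MHD_antipodel], [MHD_antipoder]). For
    the conjugations it suffices that [tau alpha' sigma = alpha] and [tau
    beta' sigma = beta], [(alpha', beta')] being the conjugated index
    ([crossed_mul_aut]). The remaining axioms compare automorphisms, and
    follow from the multiplication of [G]. *)

Set Implicit Arguments.
Unset Strict Implicit.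
Unset Printing Implicit Defensive.

Import GRing.Theory.
Local Open Scope ring_scope.

(** * Linear maps and Sweedler sums *)

Section Linearity.
Variable k : fieldType.
Implicit Types U V W X : vectType k.

(** A head symbol for linearity that the tactic [lin] below can recognize. *)
Definition lin U W (f : U -> W) : Prop := linear f.

Lemma lin_id U : lin (fun x : U => x). Proof. by []. Qed.

Lemma lin_lfun U V W (f : 'Hom(V, W)) (E : U -> V) :
  lin E -> lin (fun x => f (E x)).
Proof. by move=> lE a x y; rewrite lE linearP. Qed.

Lemma lin_fun U V W (f : V -> W) (E : U -> V) :
  lin f -> lin E -> lin (fun x => f (E x)).
Proof. by move=> lf lE a x y; rewrite lE lf. Qed.

Lemma lin_eval U V W (E : U -> 'Hom(V, W)) v :
  lin E -> lin (fun x => E x v).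
Proof. by move=> lE a x y; rewrite lE add_lfunE scale_lfunE. Qed.

Lemma lin_scalel U W (E : U -> k^o) (w : W) :
  lin E -> lin (fun x => (E x : k) *: w).
Proof. by move=> lE a x y; rewrite lE scalerDl scalerA. Qed.

Lemma lin_scaler U W (c : k) (E : U -> W) : lin E -> lin (fun x => c *: E x).
Proof. by move=> lE a x y; rewrite lE scalerDr !scalerA mulrC. Qed.

Lemma lin_mul (A : vectType k) U V V' (m : V -> V' -> A)  (E : U -> V) v :
  is_bilinear m -> lin E -> lin (fun x => m (E x) v).
Proof. by move=> [_ ml] lE a x y; rewrite lE ml. Qed.

Lemma lin_mulr (A : vectType k) U V V' (m : V -> V' -> A)  (E : U -> V') v :
  is_bilinear m -> lin E -> lin (fun x => m v (E x)).
Proof. by move=> [mr _] lE a x y; rewrite lE mr. Qed.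

Lemma lin_ptensl U V V' (E : U -> V) (v : V') :
  lin E -> lin (fun x => E x \ox v).
Proof. exact/lin_mul/ptens_bilinear. Qed.

Lemma lin_ptensr U V V' (E : U -> V') (v : V) :
  lin E -> lin (fun x => v \ox E x).
Proof. exact/lin_mulr/ptens_bilinear. Qed.

Lemma lin_swt U V V' W (E : U -> tens V V') (F : V -> V' -> W) :
  lin E -> lin (fun x => \sw_(a, b <- E x) F a b).
Proof. by move=> lE a x y; rewrite lE sweedler_linear. Qed.

Lemma lin_swF U V V' W (t : tens V V') (F : V -> V' -> U -> W) :
  (forall a b, lin (F a b)) -> lin (fun x => \sw_(a, b <- t) F a b x).
Proof. by move=> lF; apply: sweedler_linearr. Qed.

Lemma linZ U W (F : U -> W) c x : lin F -> F (c *: x) = c *: F x.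
Proof.
move=> lF; have F0 : F 0 = 0.
  by have := lF (-1) 0 0; rewrite scaler0 addr0 scaleN1r addNr.
by have := lF c x 0; rewrite !addr0 F0 addr0.
Qed.

Lemma lfunZ U W (f : 'Hom(U, W)) c x : f (c *: x) = c *: f x.
Proof. exact: linearZ. Qed.

Lemma eq_sw U V W (t : tens U V) (F F' : U -> V -> W) :
  (forall a b, F a b = F' a b) -> \sw_(a, b <- t) F a b = \sw_(a, b <- t) F' a b.
Proof.
by move=> e; apply: eq_bigr => i _; apply: eq_bigr => j _; rewrite e.
Qed.

Lemma lin_sw U V W X (f : W -> X) (lf : lin f) (t : tens U V) (F : U -> V -> W) :
  f (\sw_(a, b <- t) F a b) = \sw_(a, b <- t) f (F a b).
Proof.
rewrite /sweedler !pair_bigA /=; exact: linear_sumE.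
Qed.

Lemma sw_exchange U V U' V' W (t : tens U V) (s : tens U' V')
    (F : U -> V -> U' -> V' -> W) :
  \sw_(a, b <- t) \sw_(c, d <- s) F a b c d
  = \sw_(c, d <- s) \sw_(a, b <- t) F a b c d.
Proof.
rewrite /sweedler !pair_bigA /=.
under eq_bigr => i _ do rewrite pair_bigA scaler_sumr.
under [in RHS]eq_bigr => j _ do rewrite pair_bigA scaler_sumr.
rewrite exchange_big; apply: eq_bigr => j _; apply: eq_bigr => i _.
by rewrite !scalerA mulrC.
Qed.

Lemma sw_pure U V W (F : U -> V -> W) u v :
  (forall u, lin (F u)) -> (forall v, lin (F^~ v)) ->
  \sw_(a, b <- u \ox v) F a b = F u v.
Proof. by move=> *; apply: sweedlerE. Qed.

Lemma sw_tmap U U' V V' W (f : 'Hom(U, U')) (g : 'Hom(V, V')) (t : tens U V)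
    (F : U' -> V' -> W) :
  (forall u, lin (F u)) -> (forall v, lin (F^~ v)) ->
  \sw_(a, b <- tmap f g t) F a b = \sw_(a, b <- t) F (f a) (g b).
Proof.
move=> lF lF'.
rewrite /tmap (lin_sw (f := fun t => \sw_(a, b <- t) F a b)) //.
  by apply: eq_sw => a b; apply: sw_pure.
exact: sweedler_linear.
Qed.

Lemma sw_sw U V U' V' W (t : tens U V) (F : U -> V -> tens U' V')
    (F' : U' -> V' -> W) :
  \sw_(a, b <- \sw_(u, v <- t) F u v) F' a b
  = \sw_(u, v <- t) \sw_(a, b <- F u v) F' a b.
Proof.
apply: (lin_sw (f := fun t => \sw_(a, b <- t) F' a b)); exact: sweedler_linear.
Qed.

(** A tensor is determined by its contractions against functionals on the
    second factor: they recover its columns. *)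
Lemma tens_eq0 U V (t : tens U V) :
  (forall psi : 'Hom(V, k^o), \sw_(a, b <- t) ((psi b : k) *: a) = 0) -> t = 0.
Proof.
move=> t0; apply/matrixP => i j; rewrite mxE.
have lc : lin (coord (vbasis {:V}) j : V -> k^o).
  by move=> a x y; rewrite linearP.
have := t0 (linfun (coord (vbasis {:V}) j : V -> k^o)).
have /freeP fr := basis_free (vbasisP {:U}).
move=> e; apply: (fr (fun i => (t : 'M_(_, _)) i j)); rewrite -[RHS]e.
apply: eq_bigr => i' _; rewrite (bigD1 j) //= big1 ?addr0 => [|j' ne].
  by rewrite linfunP // coord_free ?eqxx ?scale1r ?(basis_free (vbasisP _)).
rewrite linfunP // coord_free ?(basis_free (vbasisP _)) //.
by rewrite (negPf ne) scale0r scaler0.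
Qed.

Lemma vect_eq0 U (u : U) : (forall phi : 'Hom(U, k^o), phi u = 0) -> u = 0.
Proof.
move=> u0; rewrite [u]vect_coord big1 // => i _.
have lc : lin (coord (vbasis {:U}) i : U -> k^o).
  by move=> a x y; rewrite linearP.
by rewrite -(linfunP lc) u0 scale0r.
Qed.

Definition jointly_injective (I : Type) U W (f : I -> 'Hom(U, W)) :=
  forall u v, (forall i, f i u = f i v) -> u = v.

Lemma jointly_injective0 (I : Type) U W (f : I -> 'Hom(U, W)) :
  (forall u, (forall i, f i u = 0) -> u = 0) -> jointly_injective f.
Proof.
move=> f0 u v e; apply/eqP; rewrite -subr_eq0; apply/eqP/f0 => i.
by rewrite linearB /= e subrr.
Qed.

(** Lets an identity between tensors be tested by evaluating each factor
    separately; a contraction in one factor reduces it to the other one. *)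
Lemma tmap_jointly_injective (I J : Type) U U' V V'
    (f : I -> 'Hom(U, U')) (g : J -> 'Hom(V, V')) :
  jointly_injective f -> jointly_injective g ->
  forall s t : tens U V,
    (forall i j, tmap (f i) (g j) s = tmap (f i) (g j) t) -> s = t.
Proof.
move=> fi gj s t e; apply/eqP; rewrite -subr_eq0; apply/eqP.
set d := s - t.
have d0 i j : tmap (f i) (g j) d = 0.
  have -> : d = (-1) *: t + s by rewrite scaleN1r addrC.
  by rewrite tmap_linear e scaleN1r addNr.
apply: tens_eq0 => psi; apply: fi => i; rewrite linear0.
apply: vect_eq0 => phi.
rewrite (lin_sw (f := fun u => phi (f i u))); last first.
  by apply/lin_lfun/lin_lfun/lin_id.
have v0 : \sw_(a, b <- d) ((phi (f i a) : k) *: b) = 0.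
  apply: gj => j; rewrite linear0 (lin_sw (f := g j)); last exact: linearP.
  pose F a b := (phi a : k) *: b : V'.
  have F2 a : lin (F a) by apply/lin_scaler/lin_id.
  have F1 b : lin (F^~ b) by apply/lin_scalel/lin_lfun/lin_id.
  have := sw_tmap (f i) (g j) d F2 F1; rewrite d0.
  rewrite -[0 in LHS](scale0r 0) (linZ _ _ (@sweedler_linear _ _ _ _ F)) scale0r.
  by move=> ->; apply: eq_sw => a b; rewrite lfunZ.
transitivity (psi (\sw_(a, b <- d) ((phi (f i a) : k) *: b)));
  last by rewrite v0 linear0.
rewrite (lin_sw (f := psi)); last exact: linearP.
by apply: eq_sw => a b; rewrite !lfunZ [LHS]mulrC.
Qed.

End Linearity.

(** * The ordinary Hopf algebra underlying a Hom-Hopf algebra *)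

Section Untwist.
Variables (k : fieldType) (H : homHopf k).
Implicit Types W : vectType k.
Implicit Types (a b c h l x y z : H) (s t : hopfAut H).

Notation xi := (hxi H).
Notation eps := (heps H).
Notation one := (hone H).

Let Halg := hh_alg (hopfP H).
Let Hcoalg := hh_coalg (hopfP H).

(** [xi] commutes with itself, so it is one of the automorphisms: all the
    bookkeeping of twists becomes computation in the automorphism group, where
    it is central. *)
Lemma xi_aut : is_hopf_aut xi.
Proof.
split; first exact: ha_bij Halg.
  by split=> *; rewrite ?(ha_xiM Halg) ?(ha_xi1 Halg).
by split=> *; rewrite ?(hc_Dxi Hcoalg) ?(hc_exi Hcoalg).
Qed.

Definition xiA : hopfAut H := HopfAut (asboolT xi_aut).

Lemma hopfAut_mulE s t x : (s * t)%g x = s (t x).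
Proof. exact: comp_lfunE. Qed.
Lemma hopfAut1E x : (1%g : hopfAut H) x = x.
Proof. exact: id_lfunE. Qed.
Lemma hopfAutK s x : (s^-1)%g (s x) = x.
Proof. by rewrite -hopfAut_mulE mulVg hopfAut1E. Qed.
Lemma hopfAutVK s x : s ((s^-1)%g x) = x.
Proof. by rewrite -hopfAut_mulE mulgV hopfAut1E. Qed.
Lemma aut_xiC s : commute s xiA.
Proof.
apply: val_inj; apply/lfunP => x; rewrite [LHS]hopfAut_mulE [RHS]hopfAut_mulE /=.
by have [_ ma _] := hopfAutP s; rewrite (ham_xi ma).
Qed.
Lemma aut_xi s x : s (xiA x) = xiA (s x).
Proof. by rewrite -!hopfAut_mulE (aut_xiC s). Qed.
Lemma aut_xiV s x : s ((xiA^-1)%g x) = (xiA^-1)%g (s x).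
Proof. by rewrite -!hopfAut_mulE (commuteV (aut_xiC s)). Qed.

(** Undoing the twists of the product and of the coproduct leaves an ordinary
    algebra and an ordinary coalgebra. *)
Definition umul a b : H := (xiA^-1)%g (hmul a b).
Local Notation "a ** b" := (umul a b) (at level 40, left associativity).

Definition uDelta : 'Hom(H, tens H H) := (linfun (tmap xi xi) \o hDelta H)%VF.

Lemma hmulE a b : hmul a b = xiA (a ** b).
Proof. by rewrite /umul hopfAutVK. Qed.

Lemma umul_bilinear : is_bilinear umul.
Proof.
have [br bl] := hmul_bilinear H.
by split=> u a x y; rewrite /umul ?br ?bl linearP.
Qed.

Lemma aut_umul s a b : s (a ** b) = s a ** s b.
Proof.
rewrite /umul -hopfAut_mulE (commuteV (aut_xiC s)) hopfAut_mulE.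
by have [_ ma _] := hopfAutP s; rewrite (ham_M ma).
Qed.

Lemma aut_one s : s one = one.
Proof. by have [_ ma _] := hopfAutP s; rewrite (ham_1 ma). Qed.

Lemma aut_eps s x : eps (s x) = eps x.
Proof. by have [_ _ ma] := hopfAutP s; rewrite (hcm_e ma). Qed.

Lemma umulA a b c : a ** (b ** c) = a ** b ** c.
Proof.
have := ha_mulA Halg a b c; rewrite !hmulE => /(bij_inj (hopfAut_bij xiA)).
by rewrite -!(aut_umul xiA) => /(bij_inj (hopfAut_bij xiA)).
Qed.

Lemma umul1r a : a ** one = a.
Proof. by rewrite /umul (ha_mul1r Halg) hopfAutK. Qed.
Lemma umul1l a : one ** a = a.
Proof. by rewrite /umul (ha_mul1l Halg) hopfAutK. Qed.

Lemma uDeltaE x : uDelta x = tmap xi xi (hDelta H x).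
Proof. by rewrite comp_lfunE linfunP //; apply: tmap_linear. Qed.

End Untwist.
Notation "a ** b" := (umul a b) (at level 40, left associativity) : ring_scope.

(** Linearity of an expression in one of its variables, by descending along the
    single occurrence of that variable. *)
Ltac lin1 :=
  (* Unification may have eta-reduced the function. *)
  lazymatch goal with |- lin ?f => change (lin (fun x => f x)) end;
  cbv beta;
  (* In the branches below, [type of c] fails exactly if [c] contains the bound
     variable. *)
  first
  [ exact: lin_id | assumption | solve [auto]
  | lazymatch goal with
    | |- lin (fun lin_var => fun_of_lfun ?c _) =>
        tryif (let ty := type of c in idtac)
        then apply: lin_lfun
        else apply: lin_eval
    | |- lin (fun lin_var => umul ?c _) =>
        tryif (let ty := type of c in idtac)
        then apply: (lin_mulr _ (umul_bilinear _))
        else apply: (lin_mul _ (umul_bilinear _))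
    | |- lin (fun lin_var => hmul ?c _) =>
        tryif (let ty := type of c in idtac)
        then apply: (lin_mulr _ (hmul_bilinear _))
        else apply: (lin_mul _ (hmul_bilinear _))
    | |- lin (fun lin_var => ?c \ox _) =>
        tryif (let ty := type of c in idtac)
        then apply: lin_ptensr
        else apply: lin_ptensl
    | |- lin (fun lin_var => sweedler ?c _) =>
        tryif (let ty := type of c in idtac)
        then apply: lin_swF => ? ? else apply: lin_swt
    | |- lin (fun x => tmap _ _ _) => rewrite /tmap
    | |- lin (fun lin_var => ?c *: _) =>
        tryif (let ty := type of c in idtac)
        then apply: lin_scaler
        else apply: lin_scalel
    | |- lin (fun x => ?F _ _ _ _ _) =>
        first [ apply: (@lin_fun _ _ _ _ (fun a => F a _ _ _ _)); first by auto
              | apply: (@lin_fun _ _ _ _ (fun a => F _ a _ _ _)); first by auto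
              | apply: (@lin_fun _ _ _ _ (fun a => F _ _ a _ _)); first by auto
              | apply: (@lin_fun _ _ _ _ (fun a => F _ _ _ a _)); first by auto
              | apply: (@lin_fun _ _ _ _ (fun a => F _ _ _ _ a)); first by auto ]
    | |- lin (fun x => ?F _ _ _ _) =>
        first [ apply: (@lin_fun _ _ _ _ (fun a => F a _ _ _)); first by auto
              | apply: (@lin_fun _ _ _ _ (fun a => F _ a _ _)); first by auto
              | apply: (@lin_fun _ _ _ _ (fun a => F _ _ a _)); first by auto
              | apply: (@lin_fun _ _ _ _ (fun a => F _ _ _ a)); first by auto ]
    | |- lin (fun x => ?F _ _ _) =>
        first [ apply: (@lin_fun _ _ _ _ (fun a => F a _ _)); first by auto
              | apply: (@lin_fun _ _ _ _ (fun a => F _ a _)); first by auto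
              | apply: (@lin_fun _ _ _ _ (fun a => F _ _ a)); first by auto ]
    | |- lin (fun x => ?F _ _) =>
        first [ apply: (@lin_fun _ _ _ _ (fun a => F a _)); first by auto
              | apply: (@lin_fun _ _ _ _ (fun a => F _ a)); first by auto ]
    | |- lin (fun x => ?F _) =>
        first [ apply: (@lin_fun _ _ _ _ (fun a => F a)); first by auto ]
    end ].

(* Failing at once on other goals keeps [try by lin] from trying to close, by
   conversion, the equation that is being rewritten. *)
Ltac lin :=
  intros; lazymatch goal with |- lin _ => idtac end; repeat (progress lin1).

(** * Sweedler calculus *)

Section HopfCalculus.
Variables (k : fieldType) (H : homHopf k).
Implicit Types W : vectType k.
Implicit Types (a b c h l x y z : H) (s t : hopfAut H).

Notation xi := (hxi H).
Notation eps := (heps H).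
Notation one := (hone H).
Notation D := (uDelta H).

Let Halg := hh_alg (hopfP H).
Let Hcoalg := hh_coalg (hopfP H).

Section Rules.
Variables (W : vectType k) (F : H -> H -> W).
Hypotheses (F2 : forall a, lin (F a)) (F1 : forall b, lin (F^~ b)).

Lemma sw_aut s x :
  \sw_(a, b <- D (s x)) F a b = \sw_(a, b <- D x) F (s a) (s b).
Proof.
have [_ _ ms] := hopfAutP s.
rewrite !uDeltaE (hcm_D ms) !sw_tmap //; try by lin.
by apply: eq_sw => a b; rewrite -![xi _]/(xiA H _) -!hopfAut_mulE (aut_xiC s).
Qed.

Lemma sw_hDelta x : \sw_(a, b <- hDelta H x) F a b
  = \sw_(a, b <- D x) F ((xiA H)^-1%g a) ((xiA H)^-1%g b).
Proof.
rewrite uDeltaE sw_tmap; try by lin.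
by apply: eq_sw => a b; rewrite -![xi _]/(xiA H _) !hopfAutK.
Qed.

(** The twists of product and coproduct cancel because [xi] is multiplicative
    and comultiplicative. *)
Lemma sw_mul x y :
  \sw_(a, b <- D (x ** y)) F a b
  = \sw_(a, b <- D x) \sw_(c, d <- D y) F (a ** c) (b ** d).
Proof.
rewrite sw_aut !uDeltaE (hh_DM (hopfP H)).
rewrite !sw_tmap; try by lin.
rewrite /tmul sw_sw; apply: eq_sw => a b.
rewrite sw_sw !sw_tmap; try by lin.
apply: eq_sw => c d; rewrite sw_pure; try by lin.
by rewrite !hmulE -![xi _]/(xiA H _) !hopfAutK !aut_umul.
Qed.

Lemma sw_one : \sw_(a, b <- D one) F a b = F one one.
Proof.
rewrite uDeltaE (hh_D1 (hopfP H)) sw_tmap // sw_pure; try by lin.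
by rewrite -![xi _]/(xiA H _) !aut_one.
Qed.
End Rules.

Lemma eps_mul x y : eps (x ** y) = (eps x : k) * eps y.
Proof. by rewrite aut_eps (hh_eM (hopfP H)). Qed.

Lemma eps_one : eps one = 1.
Proof. exact: hh_e1 (hopfP H). Qed.

Section Counit.
Variables (W : vectType k) (F : H -> W).
Hypothesis lF : lin F.

Lemma sw_counitl x : \sw_(a, b <- D x) (eps a *: F b) = F x.
Proof.
rewrite -{2}[x](hopfAutVK (xiA H)) -[(xiA H)^-1%g x]/((hxi H)^-1%VF x).
rewrite -(hc_counitl Hcoalg) (lin_sw (f := fun x => F (xiA H x))); last by lin.
rewrite uDeltaE sw_tmap; try by lin.
apply: eq_sw => a b.
by rewrite lfunZ -![xi _]/(xiA H _) aut_eps (linZ (F := F)).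
Qed.

Lemma sw_counitr x : \sw_(a, b <- D x) (eps b *: F a) = F x.
Proof.
rewrite -{2}[x](hopfAutVK (xiA H)) -[(xiA H)^-1%g x]/((hxi H)^-1%VF x).
rewrite -(hc_counitr Hcoalg) (lin_sw (f := fun x => F (xiA H x))); last by lin.
rewrite uDeltaE sw_tmap; try by lin.
apply: eq_sw => a b.
by rewrite lfunZ -![xi _]/(xiA H _) aut_eps (linZ (F := F)).
Qed.
End Counit.

Lemma sw_coassoc W (F : H -> H -> H -> W) x :
  (forall b c, lin (fun a => F a b c)) ->
  (forall a c, lin (fun b => F a b c)) -> (forall a b, lin (F a b)) ->
  \sw_(a, b <- D x) \sw_(c, d <- D a) F c d b
  = \sw_(a, b <- D x) \sw_(c, d <- D b) F a c d.
Proof.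
move=> l1 l2 l3; set X := (X in _ = X).
pose G a b c := F (xi (xi a)) (xi (xi b)) (xi (xi c)).
have := congr1 (fun r : tens H (tens H H) => \sw_(a, u <- r) \sw_(b, c <- u) G a b c)
          (hc_coassoc Hcoalg x).
rewrite sw_tmap; try by rewrite /G; lin.
rewrite /tassoc sw_sw sw_tmap; try by rewrite /G; lin.
rewrite /X !uDeltaE !sw_tmap; try by lin.
have e a : (xi^-1)%VF (xi a) = a by rewrite (hopfAutK (xiA H)).
have e' a : xi ((xi^-1)%VF a) = a by rewrite (hopfAutVK (xiA H)).
under eq_sw => a b do rewrite /G e'.
under [in X in _ = X]eq_sw => a b do rewrite sw_sw.
move=> eq.
transitivity (\sw_(a, b <- hDelta H x) \sw_(c, d <- hDelta H a)
                F (xi (xi c)) (xi (xi d)) (xi b)).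
  apply: eq_sw => a b; rewrite -[xi a]/(xiA H a) sw_aut; try by lin.
  by rewrite uDeltaE sw_tmap; try by lin.
transitivity (\sw_(a, b <- hDelta H x) \sw_(c, d <- hDelta H b)
                F (xi a) (xi (xi c)) (xi (xi d))); last first.
  apply: eq_sw => a b; rewrite -[xi b]/(xiA H b) [in RHS]sw_aut; try by lin.
  by rewrite uDeltaE sw_tmap; try by lin.
rewrite eq; apply: eq_sw => a b.
apply: eq_sw => c d; rewrite sw_pure; try by rewrite /G; lin.
rewrite sw_pure; try by rewrite /G; lin.
by rewrite /G e'.
Qed.
End HopfCalculus.

(** * The antipode and its inverse *)

Section Antipode.
Variables (k : fieldType) (H : homHopf k).
Implicit Types W : vectType k.
Implicit Types (a b c h l x y z : H) (s t : hopfAut H).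

Notation S := (hS H).
Notation eps := (heps H).
Notation one := (hone H).
Notation D := (uDelta H).

Lemma sw_antipodel x : \sw_(a, b <- D x) (S a ** b) = eps x *: one.
Proof.
have /(congr1 (xiA H)^-1%g) := hh_Sl (hopfP H) (xiA H x).
rewrite sw_hDelta ?sw_aut; try by lin.
rewrite lfunZ aut_one aut_eps => <-.
rewrite (lin_sw (f := (xiA H)^-1%g)); last exact: linearP.
by apply: eq_sw => a b; rewrite !hopfAutK.
Qed.

Lemma sw_antipoder x : \sw_(a, b <- D x) (a ** S b) = eps x *: one.
Proof.
have /(congr1 (xiA H)^-1%g) := hh_Sr (hopfP H) (xiA H x).
rewrite sw_hDelta ?sw_aut; try by lin.
rewrite lfunZ aut_one aut_eps => <-.
rewrite (lin_sw (f := (xiA H)^-1%g)); last exact: linearP.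
by apply: eq_sw => a b; rewrite !hopfAutK.
Qed.

(** In the convolution algebra, [f = (f * id) * S]: an identity about [f] may
    be tested after convolving with [id], as [S] is its inverse there. *)
Lemma conv_cancel (f : H -> H) x : lin f ->
  f x = \sw_(a, b <- D x) ((\sw_(c, d <- D a) (f c ** d)) ** S b).
Proof.
move=> lf; under eq_sw => a b do
  [rewrite (lin_sw (f := fun y => y ** S b)); last by lin].
rewrite (sw_coassoc (F := fun c d b => f c ** d ** S b)); try by lin.
rewrite -[LHS](sw_counitr (F := f)) //; apply: eq_sw => a b.
under [RHS]eq_sw => c d do rewrite -umulA.
rewrite -(lin_sw (f := umul (f a))); last by lin.
by rewrite sw_antipoder linZ ?umul1r; last by lin.
Qed.

(** Cancelling [id] one variable at a time: convolving [x |-> S (x ** y)] with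
    [id] gives [S y] times the counit, which is in turn shown by convolving in
    the variable [y]. *)
Lemma S_mul x y : S (x ** y) = S y ** S x.
Proof.
have e z b : \sw_(x1, x2 <- D z) (S (x1 ** b) ** x2) = eps z *: S b.
  rewrite (conv_cancel (f := fun b => \sw_(x1, x2 <- D z) (S (x1 ** b) ** x2)));
    last by lin.
  rewrite -(sw_counitl (F := fun b => eps z *: S b)); last by lin.
  apply: eq_sw => c d; cbv beta.
  suff -> : \sw_(b1, b2 <- D c)
              ((\sw_(x1, x2 <- D z) (S (x1 ** b1) ** x2)) ** b2)
            = eps c *: (eps z *: one).
    by rewrite !(linZ (F := fun x => x ** S d)) ?umul1l //; lin.
  under eq_sw => b1 b2 do
    [rewrite (lin_sw (f := fun y => y ** b2)); last by lin].
  rewrite sw_exchange.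
  transitivity (\sw_(a, b <- D (z ** c)) (S a ** b)).
    rewrite sw_mul; try by lin.
    by apply: eq_sw => p q; apply: eq_sw => r s; rewrite umulA.
  by rewrite sw_antipodel eps_mul mulrC scalerA.
rewrite (conv_cancel (f := fun x => S (x ** y))); last by lin.
rewrite -(sw_counitl (F := fun x => S y ** S x)); last by lin.
apply: eq_sw => a b; cbv beta; rewrite e.
by rewrite (linZ (F := fun x => x ** S b)) //; lin.
Qed.

(** Brings the two inner factors of a fourfold coproduct together, where the
    antipode axioms can cancel them. *)
Lemma sw_coassoc4 W (F : H -> H -> H -> H -> W) x :
  (forall b c d, lin (fun a => F a b c d)) ->
  (forall a c d, lin (fun b => F a b c d)) ->
  (forall a b d, lin (fun c => F a b c d)) ->
  (forall a b c, lin (fun d => F a b c d)) ->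
  \sw_(u, v <- D x) \sw_(a, b <- D u) \sw_(c, d <- D v) F a b c d
  = \sw_(a, u <- D x) \sw_(v, d <- D u) \sw_(b, c <- D v) F a b c d.
Proof.
move=> l1 l2 l3 l4.
rewrite (sw_coassoc (F := fun a b v => \sw_(c, d <- D v) F a b c d));
  try by lin.
apply: eq_sw => a u.
by rewrite -(sw_coassoc (F := F a)); try by lin.
Qed.

Lemma S_one : S one = one.
Proof.
have := sw_antipodel one; rewrite sw_one; try by lin.
by rewrite umul1r eps_one scale1r.
Qed.

Lemma S_eps x : eps (S x) = eps x.
Proof.
have := congr1 eps (sw_antipodel x).
rewrite lfunZ eps_one (lin_sw (f := eps)); last exact: linearP.
rewrite [RHS]mulr1 => <-; rewrite -[LHS](sw_counitr (F := fun x => eps (S x)));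
  last by lin.
by apply: eq_sw => a b; rewrite eps_mul [LHS]mulrC.
Qed.

(** Convolve the coproduct of [S x] with the coproduct of [x] and then with the
    flipped [S \ox S]: cancelling the first pair of factors gives one side,
    cancelling the last ones the other. *)
Lemma S_comul W (F : H -> H -> W) x :
  (forall a, lin (F a)) -> (forall b, lin (F^~ b)) ->
  \sw_(a, b <- D (S x)) F a b = \sw_(a, b <- D x) F (S b) (S a).
Proof.
move=> F2 F1.
transitivity (\sw_(u, v <- D x) \sw_(c, d <- D u) \sw_(p, q <- D (S c ** d))
                \sw_(v1, v2 <- D v) F (p ** S v2) (q ** S v1)); last first.
  rewrite -[RHS](sw_counitl (F := fun x => \sw_(a, b <- D x) F (S b) (S a)));
    last by lin.
  apply: eq_sw => u v.
  pose L y := \sw_(p, q <- D y) \sw_(v1, v2 <- D v) F (p ** S v2) (q ** S v1).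
  have lL : lin L by rewrite /L; lin.
  rewrite -(lin_sw lL) sw_antipodel (linZ _ _ lL) /L.
  congr (_ *: _); rewrite sw_one; try by lin.
  by apply: eq_sw => a b; rewrite !umul1l.
rewrite (sw_coassoc (F := fun c d v => \sw_(p, q <- D (S c ** d))
                \sw_(v1, v2 <- D v) F (p ** S v2) (q ** S v1))); try by lin.
rewrite -[LHS](sw_counitr (F := fun x => \sw_(a, b <- D (S x)) F a b));
  last by lin.
apply: eq_sw => c w; cbv beta.
under [RHS]eq_sw => d v do [rewrite sw_mul; try by lin].
rewrite [RHS]sw_exchange.
rewrite (lin_sw (f := fun v : W => eps w *: v)); last by lin.
apply: eq_sw => p q.
rewrite (sw_coassoc4 (F := fun d1 d2 v1 v2 => F (p ** d1 ** S v2) (q ** d2 ** S v1)));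
  try by lin.
transitivity (\sw_(d1, v2 <- D w) F (p ** d1 ** S v2) q).
  transitivity (F (p ** (\sw_(d1, v2 <- D w) (d1 ** S v2))) q).
    rewrite sw_antipoder (linZ (F := fun x => F (p ** x) q)) ?umul1r //; lin.
  rewrite (lin_sw (f := fun x => F (p ** x) q)); last by lin.
  by apply: eq_sw => a b; rewrite umulA.
apply: eq_sw => d1 r.
rewrite -(sw_counitl (F := fun v2 => F (p ** d1 ** S v2) q)); last by lin.
apply: eq_sw => s v2.
transitivity (F (p ** d1 ** S v2) (q ** (\sw_(d2, v1 <- D s) (d2 ** S v1)))).
  rewrite sw_antipoder (linZ (F := fun x => F (p ** d1 ** S v2) (q ** x))).
    by rewrite umul1r.
  by lin.
rewrite (lin_sw (f := fun x => F (p ** d1 ** S v2) (q ** x))); last by lin.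
by apply: eq_sw => a b; rewrite umulA.
Qed.

(** Conjugating [S] by an automorphism gives another convolution inverse of the
    identity. *)
Lemma S_aut t x : S (t x) = t (S x).
Proof.
suff e y : t (S ((t^-1)%g y)) = S y by rewrite -e hopfAutK.
rewrite (conv_cancel (f := fun y => t (S ((t^-1)%g y)))); last by lin.
rewrite -[RHS](sw_counitl (F := fun x => S x)); last by lin.
apply: eq_sw => a b.
suff -> : \sw_(c, d <- D a) (t (S ((t^-1)%g c)) ** d) = eps a *: one.
  by rewrite (linZ (F := fun x => x ** S b)) ?umul1l //; lin.
rewrite -(aut_eps (t^-1)%g) -[in RHS](aut_one t) -lfunZ -sw_antipodel.
rewrite (lin_sw (f := t)); last exact: linearP.
rewrite sw_aut; try by lin.
by apply: eq_sw => c d; rewrite aut_umul hopfAutVK.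
Qed.

Hypothesis hS_bij : bijective S.
Notation T := (S^-1)%VF.

Lemma TK x : T (S x) = x. Proof. exact: lfun_invK. Qed.
Lemma SK x : S (T x) = x. Proof. exact: lfunK_inv. Qed.

Lemma T_mul x y : T (x ** y) = T y ** T x.
Proof. by apply: (bij_inj hS_bij); rewrite S_mul !SK. Qed.

Lemma T_one : T one = one.
Proof. by apply: (bij_inj hS_bij); rewrite S_one !SK. Qed.

Lemma T_eps x : eps (T x) = eps x.
Proof. by rewrite -S_eps SK. Qed.

Lemma T_aut t x : T (t x) = t (T x).
Proof. by apply: (bij_inj hS_bij); rewrite S_aut !SK. Qed.

Lemma T_comul W (F : H -> H -> W) x :
  (forall a, lin (F a)) -> (forall b, lin (F^~ b)) ->
  \sw_(a, b <- D (T x)) F a b = \sw_(a, b <- D x) F (T b) (T a).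
Proof.
move=> F2 F1; rewrite -{2}[x]SK [RHS]S_comul; try by lin.
by apply: eq_sw => a b; rewrite !TK.
Qed.

Lemma sw_Tr x : \sw_(a, b <- D x) (b ** T a) = eps x *: one.
Proof.
apply: (bij_inj hS_bij); rewrite lfunZ S_one -sw_antipoder.
rewrite (lin_sw (f := S)); last exact: linearP.
by apply: eq_sw => a b; rewrite S_mul SK.
Qed.

Lemma sw_Tl x : \sw_(a, b <- D x) (T b ** a) = eps x *: one.
Proof.
apply: (bij_inj hS_bij); rewrite lfunZ S_one -sw_antipodel.
rewrite (lin_sw (f := S)); last exact: linearP.
by apply: eq_sw => a b; rewrite S_mul SK.
Qed.

End Antipode.

(** * The diagonal crossed product on endomorphisms *)

Section DiagonalCrossedProduct.
Variables (k : fieldType) (H : homHopf k).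
Implicit Types W : vectType k.
Implicit Types (x y z u v : H) (a b s t : hopfAut H) (F G K : H -> H).

Notation S := (hS H).
Notation eps := (heps H).
Notation one := (hone H).
Notation D := (uDelta H).
Notation T := (S^-1)%VF.

(** In terms of endomorphisms, the product of the element [u] of [H] with [G],
    evaluated at [y]. *)
Definition cross a b G u y : H :=
  \sw_(u1, v <- D u) \sw_(u2, u3 <- D v) (u2 ** G (T (b u3) ** y ** a u1)).

(** The ordinary diagonal crossed product: for the rank one maps
    [F = x |-> f x *: h] and [G = x |-> g x *: l] it is
    [f (a(h1) . g . S^-1 b(h3)) \bowtie h2 l], where the dots are the actions of
    [H] on functionals by translation of the argument. *)
Definition crossed_mul a b F G x : H := \sw_(x1, x2 <- D x) cross a b G (F x1) x2.

(** The endomorphism of [eps \bowtie 1]. *)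
Definition conv_unit x : H := eps x *: one.

Lemma lin_crossl a b G y : lin G -> lin (fun u => cross a b G u y).
Proof. by move=> lG; rewrite /cross; lin. Qed.
Lemma lin_crossr a b G u : lin G -> lin (cross a b G u).
Proof. by move=> lG; rewrite /cross; lin. Qed.
Lemma lin_crossed_mul a b F G : lin F -> lin G -> lin (crossed_mul a b F G).
Proof. by move=> lF lG; rewrite /crossed_mul /cross; lin. Qed.
Hypothesis hS_bij : bijective S.

(** Both translations are actions of [H], since [S^-1] is anti-multiplicative. *)
Lemma cross_umul a b G u v y : lin G ->
  cross a b G (u ** v) y = cross a b (cross a b G v) u y.
Proof.
move=> lG; rewrite /cross sw_mul; try by lin.
apply: eq_sw => u1 u'.
under eq_sw => v1 v' do [rewrite sw_mul; try by lin].
rewrite sw_exchange; apply: eq_sw => u2 u3.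
rewrite (lin_sw (f := umul u2)); last by lin.
apply: eq_sw => v1 v'.
rewrite (lin_sw (f := umul u2)); last by lin.
apply: eq_sw => v2 v3.
by rewrite !aut_umul T_mul // !umulA.
Qed.

(** Splitting the outer thirds of a threefold coproduct is the same as splitting
    its middle into three. *)
Lemma sw_coassoc5 W (F : H -> H -> H -> H -> H -> W) u :
  (forall q2 m p1 p2, lin (fun q1 => F q1 q2 m p1 p2)) ->
  (forall q1 m p1 p2, lin (fun q2 => F q1 q2 m p1 p2)) ->
  (forall q1 q2 p1 p2, lin (fun m => F q1 q2 m p1 p2)) ->
  (forall q1 q2 m p2, lin (fun p1 => F q1 q2 m p1 p2)) ->
  (forall q1 q2 m p1, lin (fun p2 => F q1 q2 m p1 p2)) ->
  \sw_(q, v <- D u) \sw_(m, p <- D v) \sw_(p1, p2 <- D p) \sw_(q1, q2 <- D q)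
    F q1 q2 m p1 p2
  = \sw_(q1, v <- D u) \sw_(w, p2 <- D v) \sw_(q2, r <- D w) \sw_(m, p1 <- D r)
    F q1 q2 m p1 p2.
Proof.
move=> l1 l2 l3 l4 l5.
transitivity (\sw_(q, v <- D u) \sw_(q1, q2 <- D q)
               \sw_(m, p <- D v) \sw_(p1, p2 <- D p) F q1 q2 m p1 p2).
  apply: eq_sw => q v; rewrite [RHS]sw_exchange; apply: eq_sw => m p.
  exact: sw_exchange.
rewrite (sw_coassoc (F := fun q1 q2 v => \sw_(m, p <- D v) \sw_(p1, p2 <- D p)
   F q1 q2 m p1 p2)); try by lin.
apply: eq_sw => q1 v.
rewrite [RHS](sw_coassoc (F := fun q2 r p2 => \sw_(m, p1 <- D r)
   F q1 q2 m p1 p2)); try by lin.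
apply: eq_sw => q2 v'.
by rewrite (sw_coassoc (F := F q1 q2)); try by lin.
Qed.

(** The element [u] passes through the product of [G] and [K]: its outer factors
    are split between them, since the coproduct of [S^-1] is flipped, and the
    middle ones act on [K] by [cross_umul]. *)
Lemma cross_crossed_mul a b G K u y : lin G -> lin K ->
  cross a b (crossed_mul a b G K) u y = crossed_mul a b (cross a b G u) K y.
Proof.
move=> lG lK.
have lQl z := lin_crossl a b z lK.
have lQr z := lin_crossr a b z lK.
transitivity (\sw_(y1, y2 <- D y) \sw_(q, v <- D u) \sw_(m, p <- D v)
    \sw_(p1, p2 <- D p) \sw_(q1, q2 <- D q)
    (m ** cross a b K (G (T (b p2) ** y1 ** a q1)) (T (b p1) ** y2 ** a q2))).
  rewrite {1}/cross sw_exchange; apply: eq_sw => q v.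
  rewrite sw_exchange; apply: eq_sw => m p.
  rewrite /crossed_mul (lin_sw (f := umul m)); last by lin.
  rewrite sw_mul; try by lin.
  rewrite sw_mul; try by lin.
  rewrite T_comul //; try by lin.
  rewrite sw_aut; try by lin.
  rewrite sw_exchange; apply: eq_sw => p1 p2; apply: eq_sw => y1 y2.
  by rewrite sw_aut; try by lin.
apply: eq_sw => y1 y2.
rewrite (sw_coassoc5 (F := fun q1 q2 m p1 p2 =>
   m ** cross a b K (G (T (b p2) ** y1 ** a q1)) (T (b p1) ** y2 ** a q2)));
     try by lin.
rewrite {3}/cross.
rewrite (lin_sw (f := fun z => cross a b K z y2)) //; apply: eq_sw => q1 v.
rewrite (lin_sw (f := fun z => cross a b K z y2)) //; apply: eq_sw => w p2.
by rewrite cross_umul.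
Qed.

(** By [cross_crossed_mul] both sides expand to the same expression over a
    threefold coproduct of [x]. *)
Lemma crossed_mulA a b F G K x : lin F -> lin G -> lin K ->
  crossed_mul a b F (crossed_mul a b G K) x
  = crossed_mul a b (crossed_mul a b F G) K x.
Proof.
move=> lF lG lK.
have lQl z := lin_crossl a b z lK.
have lQr z := lin_crossr a b z lK.
have lQl' z := lin_crossl a b z lG.
have lQr' z := lin_crossr a b z lG.
rewrite {1}/crossed_mul; under eq_sw => x1 x2 do rewrite cross_crossed_mul //.
rewrite /crossed_mul.
rewrite -(sw_coassoc (F := fun x1 x2 x3 => cross a b K (cross a b G (F x1) x2) x3));
  try by lin.
apply: eq_sw => x1 x3.
by rewrite (lin_sw (f := fun z => cross a b K z x3)).
Qed.

Lemma cross_eps a b u w y : cross a b (fun x => eps x *: w) u y = eps y *: (u ** w).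
Proof.
rewrite /cross.
rewrite -[RHS](sw_counitl (F := fun v : H => eps y *: (v ** w))); last by lin.
apply: eq_sw => u1 v; cbv beta.
rewrite -[RHS](sw_counitr (F := fun v : H => eps u1 *: (eps y *: (v ** w))));
  last by lin.
apply: eq_sw => u2 u3.
rewrite (linZ (F := umul u2)); last by lin.
rewrite !eps_mul T_eps // !aut_eps !scalerA; congr (_ *: _).
by rewrite mulrAC.
Qed.

Lemma crossed_mul1r a b F x : lin F -> crossed_mul a b F conv_unit x = F x.
Proof.
move=> lF; rewrite -[RHS](sw_counitr (F := F)) //.
by apply: eq_sw => x1 x2; rewrite cross_eps umul1r.
Qed.

Lemma cross_one a b G y : lin G -> cross a b G one y = G y.
Proof.
move=> lG; rewrite /cross sw_one; try by lin.
by rewrite sw_one ?aut_one ?T_one ?umul1l ?umul1r //; lin.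
Qed.

Lemma crossed_mul1l a b G x : lin G -> crossed_mul a b conv_unit G x = G x.
Proof.
move=> lG; rewrite -[RHS](sw_counitl (F := G)) //.
apply: eq_sw => x1 x2; rewrite /conv_unit (linZ (F := fun u => cross a b G u x2)).
  by rewrite cross_one.
exact: lin_crossl.
Qed.

(** Moving [s] and [t] through the translations turns [a'] and [b'] into
    [t * a' * s] and [t * b' * s]. *)
Lemma cross_aut a b a' b' s t F' F u y : lin F -> F' =1 (fun x => s (F (t x))) ->
  (t * a' * s = a)%g -> (t * b' * s = b)%g ->
  cross a' b' F' (s u) y = s (cross a b F u (t y)).
Proof.
move=> lF eF ea eb; rewrite /cross.
rewrite (lin_sw (f := s)); last exact: linearP.
have lF' : lin F' by rewrite (funext eF); lin.
rewrite sw_aut; try by lin.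
apply: eq_sw => u1 v.
rewrite (lin_sw (f := s)); last exact: linearP.
rewrite sw_aut; try by lin.
apply: eq_sw => u2 u3.
by rewrite aut_umul eF !aut_umul -T_aut // -!hopfAut_mulE ea eb.
Qed.

(** Used with [s = xi] and [t = xi^-1] for the structure automorphism, and with
    the two automorphisms that define a conjugation. *)
Lemma crossed_mul_aut a b a' b' s t F' G' F G x : lin F -> lin G ->
  F' =1 (fun x => s (F (t x))) -> G' =1 (fun x => s (G (t x))) ->
  (t * a' * s = a)%g -> (t * b' * s = b)%g ->
  crossed_mul a' b' F' G' x = s (crossed_mul a b F G (t x)).
Proof.
move=> lF lG eF eG ea eb; rewrite /crossed_mul.
have lQl z := lin_crossl a b z lG.
have lQr z := lin_crossr a b z lG.
rewrite (lin_sw (f := s)); last exact: linearP.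
rewrite sw_aut; try by lin.
apply: eq_sw => x1 x2; rewrite eF; exact: cross_aut.
Qed.

End DiagonalCrossedProduct.

(** * Elements of the dual tensored with H as endomorphisms *)

Section Evaluation.
Variables (k : fieldType) (H : homHopf k).
Implicit Types (x y z u v h l : H) (a b s t : hopfAut H).

Notation xi := (hxi H).
Notation xiV := ((xiA H)^-1)%g.
Notation S := (hS H).
Notation eps := (heps H).
Notation one := (hone H).
Notation D := (uDelta H).
Notation T := (S^-1)%VF.
Notation dual := 'Hom(hcar H, k^o).
Notation dxi := (dual_xi H).
Notation dxiV := ((dual_xi H)^-1)%VF.

(** The canonical map from [H^* \ox H] to the endomorphisms of [H]; it turns the
    pairings with [f1] and [f2] into products of arguments, so that functionals
    disappear from products and coproducts. *)
Definition endo (m : tens dual H) : 'End(H) :=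
  linfun (fun x => \sw_(f, h <- m) ((f x : k) *: h)).

Lemma endoE m x : endo m x = \sw_(f, h <- m) ((f x : k) *: h).
Proof. by rewrite linfunP // -/(lin _); lin. Qed.

Definition eval_at x : 'Hom(tens dual H, H) := linfun (fun m => endo m x).

Lemma lin_endo : lin endo.
Proof.
by move=> c m n; apply/lfunP => x; rewrite add_lfunE scale_lfunE !endoE
  sweedler_linear.
Qed.

Lemma eval_atE x m : eval_at x m = endo m x.
Proof.
by rewrite linfunP // => c m' n; rewrite lin_endo add_lfunE scale_lfunE.
Qed.

Lemma lin_eval_at : lin eval_at.
Proof.
move=> c x y; apply/lfunP => m; rewrite add_lfunE scale_lfunE !eval_atE.
exact: linearP.
Qed.

Lemma eval_at_pure x (f : dual) h : eval_at x (f \ox h) = (f x : k) *: h.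
Proof. by rewrite eval_atE endoE sw_pure //; lin. Qed.

Lemma endo_pure x (f : dual) h : endo (f \ox h) x = (f x : k) *: h.
Proof. by rewrite -eval_atE eval_at_pure. Qed.

Lemma eval_at_inj : jointly_injective eval_at.
Proof.
apply: jointly_injective0 => m m0; apply: tens_eq0 => psi.
apply/lfunP => x; rewrite zero_lfunE.
rewrite (lin_sw (f := fun g : dual => g x)); last by lin.
transitivity (psi (eval_at x m)); last by rewrite m0 linear0.
rewrite eval_atE endoE (lin_sw (f := psi)); last by lin.
by apply: eq_sw => f h; rewrite scale_lfunE lfunZ [LHS]mulrC.
Qed.

Lemma endo_inj (m n : tens dual H) : endo m =1 endo n -> m = n.
Proof. by move=> e; apply: eval_at_inj => x; rewrite !eval_atE. Qed.

Lemma endo_tmap (p : 'End(dual)) (r : H -> H) (q : 'End(H)) m x :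
  (forall f y, p f y = f (r y)) -> endo (tmap p q m) x = q (endo m (r x)).
Proof.
move=> pr; rewrite !endoE sw_tmap; try by lin.
rewrite (lin_sw (f := q)); last by lin.
by apply: eq_sw => f h; rewrite pr lfunZ.
Qed.

Lemma dual_map_bij (r : 'End(H)) : bijective r -> bijective (dual_map r).
Proof.
move=> br; exists (dual_map (r^-1)%VF) => f; apply/lfunP => x;
  by rewrite !dual_mapE ?lfunK_inv ?lfun_invK.
Qed.

Lemma dual_map_inv (r : 'End(H)) (f : dual) x : bijective r ->
  ((dual_map r)^-1)%VF f x = f ((r^-1)%VF x).
Proof.
move=> br; rewrite -{2}[f](lfunK_inv (dual_map_bij br)).
by rewrite dual_mapE lfunK_inv.
Qed.

Lemma dual_xiE (f : dual) x : dxi f x = f (xiA H x).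
Proof. exact: dual_mapE. Qed.

Lemma dual_xiVE (f : dual) x : dxiV f x = f (xiV x).
Proof. exact/dual_map_inv/(hopfAut_bij (xiA H)). Qed.

Lemma lhitE h (f : dual) x : lhit h f x = f (xiV x ** h).
Proof.
rewrite /lhit (lin_sw (f := fun g : dual => g x)); last by lin.
transitivity (f (hmul (xiV (xiV x)) (xiV h))).
  rewrite -dual_comulP; apply: eq_sw => f1 f2.
  by rewrite scale_lfunE !dual_xiVE -[(hxi H)^-1%VF h]/(xiV h) [LHS]mulrC.
by rewrite hmulE aut_umul !hopfAutVK.
Qed.

Lemma rhitE h (f : dual) x : rhit f h x = f (h ** xiV x).
Proof.
rewrite /rhit (lin_sw (f := fun g : dual => g x)); last by lin.
transitivity (f (hmul (xiV h) (xiV (xiV x)))).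
  rewrite -dual_comulP; apply: eq_sw => f1 f2.
  by rewrite scale_lfunE !dual_xiVE.
by rewrite hmulE aut_umul !hopfAutVK.
Qed.

Lemma sw_comul (W : vectType k) (f : dual) x y (w : W) :
  \sw_(f1, f2 <- dual_comul f) ((f1 x * f2 y : k) *: w) = (f (hmul x y) : k) *: w.
Proof.
rewrite -dual_comulP (lin_sw (f := fun c : k^o => (c : k) *: w)) //.
exact/lin_scalel/lin_id.
Qed.

Lemma endo_xi p m x : endo (MHD_xi p m) x = xiA H (endo m (xiV x)).
Proof.
rewrite /MHD_xi (linfunP (@tmap_linear _ _ _ _ _ dxiV xi)).
by apply: (endo_tmap (r := xiV)) => f y; rewrite dual_xiVE.
Qed.

Lemma MHD_xi_bij p : bijective (@MHD_xi k H p).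
Proof.
exists (tmap dxi ((hopfAut_val (xiA H))^-1)%VF) => m; apply: endo_inj => x.
  by rewrite (endo_tmap (r := xiA H)) ?endo_xi => [|f y]; rewrite ?dual_xiE ?hopfAutK
    -?[_^-1%VF _]/(xiV _) ?hopfAutK.
rewrite endo_xi (endo_tmap (r := xiA H)) => [|f y]; rewrite ?dual_xiE //.
by rewrite -?[_^-1%VF _]/(xiV _) !hopfAutVK.
Qed.

Lemma endo_xiV p m x : endo ((MHD_xi p)^-1%VF m) x = xiV (endo m (xiA H x)).
Proof.
by rewrite -{2}[m](lfunK_inv (MHD_xi_bij p)) endo_xi !hopfAutK.
Qed.

Lemma endo_one p x : endo (MHD_one p) x = @conv_unit k H x.
Proof. by rewrite endo_pure. Qed.

Lemma endo_phi q p m x :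
  endo (MHD_phi q p m) x
  = (q.1 * p.1^-1 * q.2^-1 * p.1)%g (endo m ((q.2 * q.1^-1)%g x)).
Proof.
rewrite -!eval_atE; move: m.
apply: tens_ext; [by apply: lin_lfun; apply: linearP |
                  by apply: lin_lfun; apply: linearP |].
by move=> f h; rewrite MHD_phiE !eval_at_pure comp_lfunE lfunZ.
Qed.

Lemma MHD_eps_endo m : MHD_eps H m = eps (endo m one).
Proof.
rewrite -!eval_atE; move: m.
apply: tens_ext; [exact: linearP | by apply: lin_lfun; apply: linearP |].
by move=> f h; rewrite MHD_epsE !eval_at_pure lfunZ [LHS]mulrC.
Qed.

Lemma eval_Delta p q m x y :
  tmap (eval_at x) (eval_at y) (MHD_Delta p q m)
  = \sw_(h1, h2 <- D (endo m (xiA H (y ** x))))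
      (xiV (q.1 h1) \ox xiV ((q.1^-1 * p.2 * q.1)%g h2)).
Proof.
rewrite -!eval_atE; move: m; apply: tens_ext.
- by move=> c m n; rewrite linearP tmap_linear.
- by rewrite -/(lin _); lin.
move=> f h; rewrite MHD_DeltaE !eval_at_pure.
rewrite (lin_sw (f := tmap (eval_at x) (eval_at y))); last exact: tmap_linear.
rewrite (linZ (F := fun h => \sw_(h1, h2 <- D h)
      (xiV (q.1 h1) \ox xiV ((q.1^-1 * p.2 * q.1)%g h2)))); last by lin.
rewrite -hmulE -sw_comul; apply: eq_sw => f1 f2.
rewrite (lin_sw (f := tmap (eval_at x) (eval_at y))); last exact: tmap_linear.
rewrite sw_hDelta; try by lin.
rewrite (lin_sw (f := fun w : tens H H => (f1 y * f2 x : k) *: w)); last by lin.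
apply: eq_sw => h1 h2; rewrite tmapE !eval_at_pure.
rewrite (linZ (F := fun w : H => w \ox _)); last by lin.
rewrite (linZ (F := fun w : H => _ \ox w)); last by lin.
rewrite scalerA mulrC; by rewrite !aut_xiV.
Qed.

Hypothesis hS_bij : bijective S.

(** The Hom-product is the ordinary crossed product twisted by [xi]; the powers
    of [xi] in the definitions of the product and of the actions are those that
    make all the other twists cancel. *)
Lemma endo_mul (p : mhdG H) m n x :
  endo (MHD_mul (p := p) m n) x
  = xiA H (crossed_mul p.1 p.2 (endo m) (endo n) (xiV x)).
Proof.
have linm := lin_endo.
rewrite -eval_atE; move: m; apply: tens_ext.
- by move=> c m m'; rewrite MHD_mul_linearl linearP.
- by rewrite -/(lin _) /crossed_mul /cross; lin.
move=> f h; move: n; apply: tens_ext.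
- by move=> c m m'; rewrite MHD_mul_linearr linearP.
- by rewrite -/(lin _) /crossed_mul /cross; lin.
move=> g l; rewrite MHD_mulE /crossed_mul.
pose X := xiA H.
transitivity (\sw_(h1, h2 <- hDelta H h) \sw_(h21, h22 <- hDelta H h2)
  \sw_(x1, x2 <- hDelta H x) ((f x1 : k) *:
    ((g (X (X (T (p.2 h22) ** xiV (xiV x2 ** p.1 h1)))) : k) *:
       hmul (X (X h21)) l))).
  rewrite (lin_sw (f := eval_at x)); last by lin.
  apply: eq_sw => h1 h2.
  rewrite (lin_sw (f := eval_at x)); last by lin.
  apply: eq_sw => h21 h22.
  rewrite eval_at_pure dual_mulE.
  rewrite (lin_sw (f := fun c : k^o => (c : k) *: _)); last by lin.
  apply: eq_sw => x1 x2.
  by rewrite lhitE rhitE !dual_xiE scalerA.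
rewrite sw_hDelta; try by lin.
rewrite (lin_sw (f := X)); last by lin.
rewrite sw_aut; try by rewrite /cross; lin.
transitivity (\sw_(x1, x2 <- D x) \sw_(u1, v <- D h) \sw_(u2, u3 <- D v)
  (f (xiV x1) : k) *: ((g (T (p.2 u3) ** xiV x2 ** p.1 u1) : k) *: X (u2 ** l))).
  rewrite [RHS]sw_exchange; apply: eq_sw => u1 v.
  rewrite sw_hDelta; try by lin.
  rewrite sw_aut; try by lin.
  rewrite [RHS]sw_exchange; apply: eq_sw => u2 u3.
  rewrite sw_hDelta; try by lin.
  apply: eq_sw => x1 x2.
  rewrite hmulE !(aut_xiV, aut_umul, hopfAutVK, T_aut hS_bij).
  by rewrite /X !hopfAutK umulA.
apply: eq_sw => x1 x2; rewrite endo_pure.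
rewrite (linZ (F := fun u => cross p.1 p.2 (endo (g \ox l)) u (xiV x2)));
  last by rewrite /cross; lin.
rewrite lfunZ /cross (lin_sw (f := X)); last by lin.
rewrite (lin_sw (f := fun u : H => (f (xiV x1) : k) *: u)); last by lin.
apply: eq_sw => u1 v.
rewrite (lin_sw (f := X)); last by lin.
rewrite (lin_sw (f := fun u : H => (f (xiV x1) : k) *: u)); last by lin.
apply: eq_sw => u2 u3.
rewrite endo_pure (linZ (F := umul u2)) ?lfunZ //; lin.
Qed.
End Evaluation.

(** * Multiplicativity of the comultiplication *)

Section Comultiplication.
Variables (k : fieldType) (H : homHopf k).
Implicit Types (x y z u v h l : H) (al be ga de B : hopfAut H).

Notation xiV := ((xiA H)^-1)%g.
Notation S := (hS H).
Notation one := (hone H).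
Notation D := (uDelta H).
Notation T := (S^-1)%VF.
Hypothesis hS_bij : bijective S.

(** The two middle factors of a sixfold coproduct are adjacent, so that
    [h4 ** S^-1 h3] collapses by the antipode axiom of the opposite algebra. *)
Lemma sw_cancel (W : vectType k) (F : H -> H -> H -> H -> H -> W) x :
  (forall b c d e, lin (fun a => F a b c d e)) ->
  (forall a c d e, lin (fun b => F a b c d e)) ->
  (forall a b d e, lin (fun c => F a b c d e)) ->
  (forall a b c e, lin (fun d => F a b c d e)) ->
  (forall a b c d, lin (fun e => F a b c d e)) ->
  \sw_(h, h' <- D x) \sw_(h1, w <- D h) \sw_(h2, h3 <- D w)
    \sw_(h4, z <- D h') \sw_(h5, h6 <- D z) F h1 h2 (h4 ** T h3) h5 h6
  = \sw_(h1, w <- D x) \sw_(g, h6 <- D w) \sw_(h2, h5 <- D g) F h1 h2 one h5 h6.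
Proof.
move=> l1 l2 l3 l4 l5.
rewrite (sw_coassoc (F := fun h1 w h' => \sw_(h2, h3 <- D w)
    \sw_(h4, z <- D h') \sw_(h5, h6 <- D z) F h1 h2 (h4 ** T h3) h5 h6));
      try by lin.
apply: eq_sw => h1 r.
rewrite (sw_coassoc4 (F := fun h2 h3 h4 z =>
    \sw_(h5, h6 <- D z) F h1 h2 (h4 ** T h3) h5 h6)); try by lin.
rewrite (sw_coassoc (F := fun h2 h5 h6 => F h1 h2 one h5 h6)); try by lin.
apply: eq_sw => h2 s.
rewrite -[RHS](sw_counitl (F := fun z => \sw_(h5, h6 <- D z) F h1 h2 one h5 h6));
  last by lin.
apply: eq_sw => v z; cbv beta.
rewrite -(linZ (F := fun c => \sw_(h5, h6 <- D z) F h1 h2 c h5 h6));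
  last by lin.
rewrite -(sw_Tr hS_bij).
by rewrite (lin_sw (f := fun c => \sw_(h5, h6 <- D z) F h1 h2 c h5 h6));
  last by lin.
Qed.

(** The ordinary form of the multiplicativity of the comultiplication. The
    translations by [ga (B h4)] and by [S^-1] of [be (ga h3)] meet between the two
    legs, and cancel because [ga * B = be * ga]. *)
Lemma uDelta_crossed_mul (W : vectType k) (Phi : H -> H -> W) al be ga de B
    (F G : H -> H) x y :
  lin F -> lin G -> (forall u, lin (Phi u)) -> (forall v, lin (Phi^~ v)) ->
  (ga * B = be * ga)%g ->
  \sw_(p, q <- D (crossed_mul (al * ga)%g (de * B)%g F G (y ** x))) Phi (ga p) (B q)
  = \sw_(x1, x2 <- D x) \sw_(y1, y2 <- D y) \sw_(h, h' <- D (F (y1 ** x1)))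
      \sw_(h1, w <- D h) \sw_(h2, h3 <- D w)
      \sw_(h4, z <- D h') \sw_(h5, h6 <- D z)
      \sw_(g1, g2 <- D (G ((T (de (B h6)) ** y2 ** ga (B h4))
                       ** (T (be (ga h3)) ** x2 ** al (ga h1)))))
        Phi (ga (h2 ** g1)) (B (h5 ** g2)).
Proof.
move=> lF lG lP1 lP2 eB.
have eB' c : ga (B c) = be (ga c) by rewrite -!hopfAut_mulE eB.
rewrite /crossed_mul sw_mul; try by rewrite /cross; lin.
rewrite sw_exchange.
pose L z := \sw_(p, q <- D z) Phi (ga p) (B q).
have lL : lin L by rewrite /L; lin.
rewrite -/(L _) (lin_sw lL); apply: eq_sw => x1 x2.
rewrite (lin_sw lL); apply: eq_sw => y1 y2.
move: (F (y1 ** x1)) => f.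
transitivity (\sw_(h, h' <- D f) \sw_(h1, w <- D h) \sw_(h2, h3 <- D w)
    \sw_(h4, z <- D h') \sw_(h5, h6 <- D z)
    \sw_(g1, g2 <- D (G (T (de (B h6)) ** y2 ** be (ga (h4 ** T h3)) ** x2
                         ** al (ga h1)))) Phi (ga (h2 ** g1)) (B (h5 ** g2)));
  last first.
  do 5!apply: eq_sw => ? ?; congr (\sw_(g1, g2 <- D (G _)) _).
  by rewrite eB' !aut_umul !T_aut // !umulA.
rewrite (sw_cancel (F := fun h1 h2 c h5 h6 =>
    \sw_(g1, g2 <- D (G (T (de (B h6)) ** y2 ** be (ga c) ** x2
                         ** al (ga h1)))) Phi (ga (h2 ** g1)) (B (h5 ** g2))));
  try by lin.
rewrite /cross (lin_sw lL); apply: eq_sw => h1 w.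
rewrite (lin_sw lL); apply: eq_sw => g h6.
rewrite /L sw_mul; try by lin.
apply: eq_sw => h2 h5.
by rewrite !aut_one umul1r !hopfAut_mulE !umulA.
Qed.

(** The product of two tensors [s] and [t] as a sum over their values, so that
    [eval_Delta] can be substituted for both. *)
Lemma eval_tmul (p q : mhdG H) (s t : tens (MHD p) (MHD q)) x y :
  tmap (eval_at x) (eval_at y) (tmul (@MHD_mul k H p) (@MHD_mul k H q) s t)
  = \sw_(x1, x2 <- D (xiV x)) \sw_(y1, y2 <- D (xiV y))
    \sw_(u, v <- tmap (eval_at x1) (eval_at y1) s)
    \sw_(u1, w <- D u) \sw_(u2, u3 <- D w)
    \sw_(v1, z <- D v) \sw_(v2, v3 <- D z)
    \sw_(m, n <- tmap (eval_at (T (p.2 u3) ** x2 ** p.1 u1))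
                      (eval_at (T (q.2 v3) ** y2 ** q.1 v1)) t)
      (xiA H (u2 ** m) \ox xiA H (v2 ** n)).
Proof.
have linm := @lin_endo k H.
have linv := @lin_eval_at k H.
have lm2 (r : mhdG H) (u : MHD r) : lin (@MHD_mul k H r u).
  exact: MHD_mul_linearr.
have lm1 (r : mhdG H) (v : MHD r) : lin ((@MHD_mul k H r)^~ v).
  exact: MHD_mul_linearl.
rewrite /tmul; move: s; apply: tens_ext; try by rewrite -/(lin _); lin.
move=> m1 n1; rewrite sw_pure; try by lin.
move: t; apply: tens_ext; try by rewrite -/(lin _); lin.
move=> m2 n2; rewrite sw_pure; try by lin.
(* Rewriting would compare the two products by unfolding them. *)
rewrite tmapE !eval_atE; apply: etrans.
  by apply: congr2; apply: endo_mul.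
rewrite /crossed_mul.
rewrite (lin_sw (f := fun a => xiA H a \ox _)); last by lin.
apply: eq_sw => x1 x2.
rewrite (lin_sw (f := fun a => _ \ox xiA H a)); last by lin.
apply: eq_sw => y1 y2.
rewrite tmapE sw_pure ?eval_atE; try by lin.
rewrite /cross (lin_sw (f := fun a => xiA H a \ox _)); last by lin.
apply: eq_sw => u1 w.
rewrite (lin_sw (f := fun a => xiA H a \ox _)); last by lin.
apply: eq_sw => u2 u3.
rewrite (lin_sw (f := fun a => _ \ox xiA H a)); last by lin.
apply: eq_sw => v1 z.
rewrite (lin_sw (f := fun a => _ \ox xiA H a)); last by lin.
apply: eq_sw => v2 v3.
by rewrite tmapE sw_pure ?eval_atE; try by lin.
Qed.

Lemma MHD_Delta_mul (p q : mhdG H) (m n : MHD (p * q)%g) :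
  MHD_Delta p q (MHD_mul m n)
  = tmul (@MHD_mul k H p) (@MHD_mul k H q) (MHD_Delta p q m) (MHD_Delta p q n).
Proof.
have linm := @lin_endo k H; have linv := @lin_eval_at k H.
apply: (tmap_jointly_injective (@eval_at_inj k H) (@eval_at_inj k H)).
move=> x y.
rewrite eval_Delta eval_tmul endo_mul // hopfAutK.
set B := (q.1^-1 * p.2 * q.1)%g.
rewrite sw_aut; try by lin.
transitivity (\sw_(a, b <- D (crossed_mul (p * q)%g.1 (p * q)%g.2
                                 (endo m) (endo n) (y ** x)))
   (q.1 a \ox B b)).
  by apply: eq_sw => a b; rewrite -(aut_xiV q.1) -(aut_xiV B) !hopfAutK.
have -> : (p * q)%g.2 = (q.2 * B)%g by rewrite /B !mulgA.
have -> : (p * q)%g.1 = (p.1 * q.1)%g by [].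
have eB : (q.1 * B = p.2 * q.1)%g by rewrite /B !mulgA mulgV mul1g.
have [lm ln] : lin (endo m) /\ lin (endo n) by split; lin.
have [lP1 lP2] : (forall a : H, lin (fun b : H => a \ox b))
  /\ (forall b : H, lin (fun a : H => a \ox b)) by split; lin.
apply: (etrans (@uDelta_crossed_mul _ (fun a b => a \ox b) p.1 p.2 q.1 q.2 B _ _ x y
                 lm ln lP1 lP2 eB)).
rewrite [RHS]sw_aut; try by lin.
apply: eq_sw => x1 x2.
rewrite [RHS]sw_aut; try by lin.
apply: eq_sw => y1 y2.
rewrite eval_Delta sw_sw -aut_umul hopfAutVK.
apply: eq_sw => h h'; rewrite sw_pure; try by lin.
rewrite [RHS]sw_aut ?[RHS]sw_aut; try by lin.
apply: eq_sw => h1 w.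
rewrite [RHS]sw_aut ?[RHS]sw_aut; try by lin.
apply: eq_sw => h2 h3.
rewrite [RHS]sw_aut ?[RHS]sw_aut; try by lin.
apply: eq_sw => h4 z.
rewrite [RHS]sw_aut ?[RHS]sw_aut; try by lin.
apply: eq_sw => h5 h6.
rewrite eval_Delta sw_sw.
rewrite !(aut_umul, T_aut hS_bij, hopfAutVK).
rewrite -/B !(aut_xiV q.2, aut_xiV q.1, aut_xiV p.2, aut_xiV p.1) !hopfAutVK.
apply: eq_sw => g1 g2; rewrite sw_pure; try by lin.
by rewrite !aut_umul !hopfAutVK.
Qed.
End Comultiplication.

(** * The Hom-algebras and the Hom-coalgebra axioms *)

Section HomCoalgebra.
Variables (k : fieldType) (H : homHopf k).
Implicit Types (x y z u v h l : H) (p q r : mhdG H).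

Notation xiV := ((xiA H)^-1)%g.
Notation S := (hS H).
Notation eps := (heps H).
Notation one := (hone H).
Notation D := (uDelta H).
Notation dual := 'Hom(hcar H, k^o).
Hypothesis hS_bij : bijective S.

Lemma MHD_hom_algebra p :
  hom_algebra (MHD_xi p) (@MHD_mul k H p) (MHD_one p).
Proof.
have lE (m : MHD p) : lin (endo m) by exact: linearP.
have xiC s : ((xiA H)^-1 * s * xiA H)%g = s by rewrite -mulgA aut_xiC mulKg.
have xiM m n : MHD_xi p (MHD_mul m n) = MHD_mul (MHD_xi p m) (MHD_xi p n).
  apply: endo_inj => x; rewrite endo_xi !endo_mul //; congr (xiA H _).
  rewrite (crossed_mul_aut hS_bij (a := p.1) (b := p.2) _ (lE m) (lE n)
     (endo_xi m) (endo_xi n)) // xiC.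
split=> //.
- exact: MHD_xi_bij.
- by split; [exact: MHD_mul_linearr | exact: MHD_mul_linearl].
- apply: endo_inj => x; rewrite endo_xi !endo_one /conv_unit lfunZ aut_one.
  by rewrite aut_eps.
- move=> a b c; apply: endo_inj => x.
  rewrite (endo_mul hS_bij (MHD_xi p a)) (endo_mul hS_bij _ (MHD_xi p c)).
  congr (xiA H _).
  have lab := lin_crossed_mul p.1 p.2 (lE a) (lE b).
  have lbc := lin_crossed_mul p.1 p.2 (lE b) (lE c).
  rewrite (crossed_mul_aut hS_bij (a := p.1) (b := p.2) _ (lE a) lbc
    (endo_xi a) (endo_mul hS_bij b c)) ?xiC //.
  rewrite (crossed_mul_aut hS_bij (a := p.1) (b := p.2) _ lab (lE c)
    (endo_mul hS_bij a b) (endo_xi c)) ?xiC //.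
  by rewrite crossed_mulA.
- move=> a; apply: endo_inj => x; rewrite endo_mul // endo_xi; congr (xiA H _).
  rewrite -[RHS](crossed_mul1r hS_bij p.1 p.2) //.
  rewrite /crossed_mul; apply: eq_sw => x1 x2; congr (cross _ _ _ _ _).
  by apply: funext => y; rewrite endo_one.
- move=> a; apply: endo_inj => x; rewrite endo_mul // endo_xi; congr (xiA H _).
  rewrite -[RHS](crossed_mul1l hS_bij p.1 p.2) //.
  by rewrite /crossed_mul; apply: eq_sw => x1 x2; rewrite endo_one.
Qed.


Definition eval2_at (yz : H * H) : 'Hom(tens (tens dual H) (tens dual H), tens H H) :=
  linfun (tmap (eval_at yz.1) (eval_at yz.2)).

Lemma eval2_atE y z t : eval2_at (y, z) t = tmap (eval_at y) (eval_at z) t.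
Proof. by rewrite linfunP //; apply: tmap_linear. Qed.

Lemma eval2_at_inj : jointly_injective eval2_at.
Proof.
move=> s t e.
apply: (tmap_jointly_injective (@eval_at_inj k H) (@eval_at_inj k H)).
by move=> y z; rewrite -!eval2_atE.
Qed.

Lemma gcastE p q (e : p = q) (m : MHD p) :
  @gcast k (mhdG H) (@MHD k H) p q e m = m.
Proof. by case: q / e. Qed.

(** Both sides are the threefold coproduct of the value of [c] at the product of
    [z], [y] and [x], with the same automorphisms applied by the law of the
    group. *)
Lemma MHD_coassoc p q r (c : tens dual H) :
  tmap (MHD_xi p)^-1%VF (MHD_Delta q r)
    (MHD_Delta p (q * r)%g (c : MHD (p * (q * r))%g))
  = tassoc (tmap (MHD_Delta p q) (MHD_xi r)^-1%VF
              (MHD_Delta (p * q)%g r (c : MHD (p * q * r)%g))).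
Proof.
have linm := @lin_endo k H; have linv := @lin_eval_at k H.
apply: (tmap_jointly_injective (@eval_at_inj k H) eval2_at_inj) => x [y z].
transitivity (\sw_(u, v <- tmap (eval_at (xiA H x)) (eval_at (xiA H (z ** y)))
                 (MHD_Delta p (q * r)%g (c : MHD (p * (q * r))%g)))
   (xiV u \ox \sw_(k1, k2 <- D v)
      (xiV (r.1 k1) \ox xiV ((r.1^-1 * q.2 * r.1)%g k2)))).
  rewrite {1}/tmap [in LHS]sw_tmap; try by lin.
  rewrite [RHS]sw_tmap; try by lin.
  apply: eq_sw => a b; rewrite eval2_atE eval_Delta !eval_atE endo_xiV.
  by [].
transitivity (\sw_(u, v <- tmap (eval_at (xiA H (y ** x))) (eval_at (xiA H z))
                 (MHD_Delta (p * q)%g r (c : MHD (p * q * r)%g)))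
   \sw_(k1, k2 <- D u) (xiV (q.1 k1) \ox
      (xiV ((q.1^-1 * p.2 * q.1)%g k2) \ox xiV v))); last first.
  rewrite [LHS]sw_tmap; try by lin.
  rewrite /tassoc (lin_sw (f := tmap (eval_at x) (eval2_at (y, z))));
    last by lin.
  rewrite [RHS]sw_tmap; try by lin.
  apply: eq_sw => a b.
  rewrite (lin_sw (f := tmap (eval_at x) (eval2_at (y, z)))); last by lin.
  transitivity (\sw_(u, v <- tmap (eval_at x) (eval_at y) (MHD_Delta p q a))
     (u \ox (v \ox eval_at z ((MHD_xi r)^-1%VF b)))); last first.
    rewrite [LHS]sw_tmap; try by lin.
    by apply: eq_sw => u v; rewrite tmapE eval2_atE tmapE.
  rewrite eval_Delta sw_sw eval_atE; apply: eq_sw => k1 k2.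
  by rewrite sw_pure ?eval_atE ?endo_xiV; try by lin.
rewrite !eval_Delta !sw_sw -!(aut_umul (xiA H)) -umulA.
move: (endo c _) => d.
transitivity (\sw_(h1, h2 <- D d) \sw_(k1, k2 <- D h2)
   (xiV (xiV (q.1 (r.1 h1))) \ox
     (xiV (xiV ((q.1^-1 * p.2 * q.1)%g (r.1 k1))) \ox
      xiV (xiV ((r.1^-1 * (q.2 * q.1^-1 * p.2 * q.1) * r.1)%g k2))))).
  apply: eq_sw => h1 h2; rewrite sw_pure; try by lin.
  rewrite sw_aut ?sw_aut; try by lin.
  rewrite (lin_sw (f := fun t => xiV (xiV ((q * r)%g.1 h1)) \ox t));
    last by lin.
  apply: eq_sw => k1 k2.
  rewrite [(q * r)%g.1]/(q.1 * r.1)%g; congr (_ \ox (_ \ox _)).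
  - by rewrite hopfAut_mulE.
  - by rewrite (aut_xiV r.1) -!hopfAut_mulE invgM !mulgA mulgK.
  - rewrite (aut_xiV (r.1^-1 * q.2 * r.1)%g) -!hopfAut_mulE invgM !mulgA.
    by rewrite mulgK.
rewrite -[LHS](sw_coassoc (F := fun h1 k1 k2 => xiV (xiV (q.1 (r.1 h1))) \ox
     (xiV (xiV ((q.1^-1 * p.2 * q.1)%g (r.1 k1))) \ox
      xiV (xiV ((r.1^-1 * (q.2 * q.1^-1 * p.2 * q.1) * r.1)%g k2)))));
        try by lin.
apply: eq_sw => h1 h2; rewrite sw_pure; try by lin.
rewrite sw_aut ?sw_aut; try by lin.
by apply: eq_sw => k1 k2; rewrite !aut_xiV.
Qed.

Lemma MHD_counitr p (c : tens dual H) :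
  \sw_(c1, c2 <- MHD_Delta p 1%g (c : MHD (p * 1)%g)) (MHD_eps H c2 *: c1)
  = (MHD_xi p)^-1%VF (c : MHD p).
Proof.
have linm := @lin_endo k H; have linv := @lin_eval_at k H.
apply: endo_inj => x; rewrite endo_xiV -eval_atE.
rewrite (lin_sw (f := eval_at x)); last exact: linearP.
transitivity (\sw_(u, v <- tmap (eval_at x) (eval_at one)
                 (MHD_Delta p 1%g (c : MHD (p * 1)%g)))
   (eps v *: u)).
  rewrite sw_tmap; try by lin.
  by apply: eq_sw => a b; rewrite lfunZ MHD_eps_endo !eval_atE.
rewrite eval_Delta sw_sw umul1l.
rewrite -[RHS](sw_counitr (F := xiV)); last by lin.
apply: eq_sw => h1 h2; rewrite sw_pure; try by lin.
by rewrite !aut_eps hopfAut1E.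
Qed.

Lemma MHD_counitl p (c : tens dual H) :
  \sw_(c1, c2 <- MHD_Delta 1%g p (c : MHD (1 * p)%g)) (MHD_eps H c1 *: c2)
  = (MHD_xi p)^-1%VF (c : MHD p).
Proof.
have linm := @lin_endo k H; have linv := @lin_eval_at k H.
apply: endo_inj => x; rewrite endo_xiV -eval_atE.
rewrite (lin_sw (f := eval_at x)); last exact: linearP.
transitivity (\sw_(u, v <- tmap (eval_at one) (eval_at x)
                 (MHD_Delta 1%g p (c : MHD (1 * p)%g)))
   (eps u *: v)).
  rewrite sw_tmap; try by lin.
  by apply: eq_sw => a b; rewrite lfunZ MHD_eps_endo !eval_atE.
rewrite eval_Delta sw_sw umul1r.
rewrite -[RHS](sw_counitl (F := xiV)); last by lin.
apply: eq_sw => h1 h2; rewrite sw_pure; try by lin.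
by rewrite !aut_eps mulg1 mulVg hopfAut1E.
Qed.

Lemma MHD_Delta_xiV p q (c : MHD (p * q)%g) :
  MHD_Delta p q ((MHD_xi (p * q)%g)^-1%VF c)
  = tmap (MHD_xi p)^-1%VF (MHD_xi q)^-1%VF (MHD_Delta p q c).
Proof.
have linm := @lin_endo k H; have linv := @lin_eval_at k H.
apply: (tmap_jointly_injective (@eval_at_inj k H) (@eval_at_inj k H)).
move=> x y.
transitivity (\sw_(u, v <- tmap (eval_at (xiA H x)) (eval_at (xiA H y))
                 (MHD_Delta p q c))
   (xiV u \ox xiV v)); last first.
  rewrite [LHS]sw_tmap; try by lin.
  rewrite [RHS](sw_tmap _ _ _ (F := fun a b => eval_at x a \ox eval_at y b));
    try by lin.
  by apply: eq_sw => a b; rewrite !eval_atE !endo_xiV.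
rewrite !eval_Delta sw_sw endo_xiV -aut_umul sw_aut; try by lin.
apply: eq_sw => a b; rewrite sw_pure; try by lin.
by rewrite !aut_xiV.
Qed.

Lemma MHD_Tcoalgebra :
  hom_Tcoalgebra (@MHD_xi k H) (@MHD_Delta k H) (@MHD_eps k H).
Proof.
split.
- exact: MHD_xi_bij.
- by move=> p q r c; rewrite gcastE; apply: MHD_coassoc.
- by move=> p c; rewrite gcastE; apply: MHD_counitr.
- by move=> p c; rewrite gcastE; apply: MHD_counitl.
- exact: MHD_Delta_xiV.
- by move=> c; rewrite !MHD_eps_endo endo_xiV aut_eps aut_one.
Qed.

End HomCoalgebra.

(** * Antipode and conjugations *)

Section Crossed.
Variables (k : fieldType) (H : homHopf k).
Implicit Types (x y z u v h l : H) (p q r : mhdG H).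

Notation xiV := ((xiA H)^-1)%g.
Notation S := (hS H).
Notation eps := (heps H).
Notation one := (hone H).
Notation D := (uDelta H).
Notation T := (S^-1)%VF.
Notation dual := 'Hom(hcar H, k^o).
Notation dxi := (dual_xi H).
Notation dxiV := ((dual_xi H)^-1)%VF.
Notation dSV := ((dual_S H)^-1)%VF.
Hypothesis hS_bij : bijective S.

Lemma dual_SVE (f : dual) x : dSV f x = f (T x).
Proof. exact: dual_map_inv. Qed.

Lemma MHD_mul_lr p (f : dual) u v :
  MHD_mul (p := p) (f \ox u) (eps \ox v) = dxiV f \ox hmul u v.
Proof.
apply: endo_inj => x; rewrite endo_mul // !endo_pure dual_xiVE hmulE -lfunZ.
congr (xiA H _); rewrite -(sw_counitr (F := fun y => f y *: (u ** v)));
  last by lin.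
apply: eq_sw => x1 x2; rewrite endo_pure.
rewrite (linZ (F := fun u => cross p.1 p.2 (endo (eps \ox v)) u x2));
  last by apply: lin_crossl; lin.
have -> : (endo (eps \ox v) : H -> H) = fun y => eps y *: v.
  by apply: funext => y; rewrite endo_pure.
by rewrite cross_eps // !scalerA mulrC.
Qed.

Lemma endo_mul_dual p (f : dual) (m : MHD p) x :
  endo (MHD_mul (p := p) (f \ox one) m) x
  = xiA H (\sw_(x1, x2 <- D (xiV x)) ((f x1 : k) *: endo m x2)).
Proof.
rewrite endo_mul //; congr (xiA H _); apply: eq_sw => x1 x2.
rewrite endo_pure (linZ (F := fun u => cross p.1 p.2 (endo m) u x2));
  last by apply: lin_crossl; exact: linearP.
by rewrite cross_one //; exact: linearP.
Qed.

Lemma dual_xiV_eps : dxiV eps = eps.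
Proof. by apply/lfunP => x; rewrite dual_xiVE aut_eps. Qed.

Lemma lin_MHD_mull p (y : MHD p) : lin ((@MHD_mul k H p)^~ y).
Proof. exact: MHD_mul_linearl. Qed.
Lemma lin_MHD_mulr p (x : MHD p) : lin (@MHD_mul k H p x).
Proof. exact: MHD_mul_linearr. Qed.

(** The components share one underlying space, so products indexed by equal
    group elements compare without transport. *)
Lemma MHD_mul_eq p q (e : p = q) (m n : tens dual H) :
  MHD_mul (p := p) m n = MHD_mul (p := q) m n.
Proof. by case: q / e. Qed.

(** Evaluated at [x], the sum is [f] at [x2 ** S^-1 x1], hence a multiple of the
    counit. *)
Lemma comul_antipodel p (f : dual) v :
  \sw_(f1, f2 <- dual_comul f)
    MHD_mul (p := p) (dSV (dxi f2) \ox one) (dxi f1 \ox v)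
  = (f one : k) *: (eps \ox xiA H v).
Proof.
apply: endo_inj => x; rewrite -!eval_atE lfunZ eval_at_pure.
rewrite (lin_sw (f := eval_at x)); last by lin.
transitivity (\sw_(x1, x2 <- D x) ((f (hmul x2 (T x1)) : k) *: xiA H v));
  last first.
  transitivity ((f (\sw_(x1, x2 <- D x) (hmul x2 (T x1))) : k) *: xiA H v).
    rewrite (lin_sw (f := fun y => (f y : k) *: xiA H v)); last by lin.
    by [].
  transitivity ((f (xiA H (\sw_(x1, x2 <- D x) (x2 ** T x1))) : k) *: xiA H v).
    congr (f _ *: _); rewrite (lin_sw (f := xiA H)); last by lin.
    by apply: eq_sw => a b; rewrite hmulE.
  by rewrite sw_Tr // !lfunZ aut_one scalerA mulrC.
transitivity (\sw_(x1, x2 <- D x) \sw_(f1, f2 <- dual_comul f)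
  ((f1 x2 * f2 (T x1) : k) *: xiA H v)); last first.
  by apply: eq_sw => x1 x2; rewrite sw_comul.
rewrite [RHS]sw_exchange; apply: eq_sw => f1 f2.
rewrite eval_atE endo_mul_dual (lin_sw (f := xiA H)); last by lin.
rewrite sw_aut; try by lin.
apply: eq_sw => x1 x2.
by rewrite endo_pure dual_SVE !dual_xiE -!T_aut // !hopfAutVK !lfunZ scalerA mulrC.
Qed.

(** As above, with [S^-1 x2 ** x1]. *)
Lemma comul_antipoder p (f : dual) :
  \sw_(f1, f2 <- dual_comul f)
    MHD_mul (p := p) (f2 \ox one) (MHD_xi p (dSV (dxi f1) \ox one))
  = (f one : k) *: (eps \ox one).
Proof.
apply: endo_inj => x; rewrite -!eval_atE lfunZ eval_at_pure.
rewrite (lin_sw (f := eval_at x)); last by lin.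
transitivity (\sw_(x1, x2 <- D (xiV x)) ((f (hmul (T x2) x1) : k) *: one));
  last first.
  transitivity ((f (\sw_(x1, x2 <- D (xiV x)) (hmul (T x2) x1)) : k) *: one).
    rewrite (lin_sw (f := fun y => (f y : k) *: one)); last by lin.
    by [].
  transitivity ((f (xiA H (\sw_(x1, x2 <- D (xiV x)) (T x2 ** x1))) : k) *: one).
    congr (f _ *: _); rewrite (lin_sw (f := xiA H)); last by lin.
    by apply: eq_sw => a b; rewrite hmulE.
  by rewrite sw_Tl // !lfunZ aut_one aut_eps scalerA mulrC.
transitivity (\sw_(x1, x2 <- D (xiV x)) \sw_(f1, f2 <- dual_comul f)
  ((f1 (T x2) * f2 x1 : k) *: one)); last first.
  by apply: eq_sw => x1 x2; rewrite sw_comul.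
rewrite [RHS]sw_exchange; apply: eq_sw => f1 f2.
rewrite eval_atE endo_mul_dual (lin_sw (f := xiA H)); last by lin.
apply: eq_sw => x1 x2.
rewrite endo_xi endo_pure dual_SVE dual_xiE -T_aut // hopfAutVK !lfunZ !aut_one scalerA.
by rewrite mulrC.
Qed.

(** Associativity brings the two functionals next to each other, where
    [comul_antipodel] collapses them; what remains is the antipode axiom of [H]
    transported by [p.2^-1]. *)
Lemma MHD_antipodel p (m : tens dual H) :
  \sw_(h1, h2 <- MHD_Delta p^-1%g p (m : MHD (p^-1 * p)%g))
    MHD_mul (p := p) (MHD_S p^-1%g h1 : MHD p^-1^-1%g) h2
  = MHD_eps H (m : MHD 1%g) *: MHD_one p.
Proof.
have lml := lin_MHD_mull; have lmr := lin_MHD_mulr.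
move: m; apply: tens_ext; try by rewrite -/(lin _); lin.
move=> f h; rewrite MHD_DeltaE MHD_epsE sw_sw.
set A := ((p^-1).1 * (p^-1).2)%g; set B := (p.1^-1 * (p^-1).2 * p.1)%g.
transitivity (\sw_(f1, f2 <- dual_comul f) \sw_(h1, h2 <- hDelta H h)
   MHD_mul (p := p) (eps \ox xiA H (A (S (xiV (p.1 h1)))))
   (MHD_mul (p := p) (dSV (dxi f2) \ox one) (dxi f1 \ox xiV (B h2)))).
  apply: eq_sw => f1 f2; rewrite sw_sw; apply: eq_sw => h1 h2.
  rewrite sw_pure; try by lin.
  rewrite MHD_SE (MHD_mul_eq (invgK p)) -/A.
  have := ha_mulA (MHD_hom_algebra hS_bij p) (eps \ox A (S (xiV (p.1 h1))))
           (dSV (dxi f2) \ox one) (dxi f1 \ox xiV (B h2)).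
  rewrite !MHD_xiE dual_xiV_eps.
  have -> : dxiV (dxi f1) = f1.
    by apply/lfunP => x; rewrite dual_xiVE dual_xiE hopfAutVK.
  by rewrite -[hxi H (xiV (B h2))]/(xiA H (xiV (B h2))) hopfAutVK => <-.
rewrite sw_exchange.
transitivity (\sw_(h1, h2 <- hDelta H h) ((f one : k) *:
    (eps \ox hmul (xiA H (A (S (xiV (p.1 h1))))) (B h2)))).
  apply: eq_sw => h1 h2.
  rewrite -(lin_sw (f := MHD_mul (p := p) (eps \ox _))); last by lin.
  rewrite comul_antipodel hopfAutVK (linZ (F := MHD_mul (p := p) _));
    last by lin.
  by rewrite MHD_mul_lr dual_xiV_eps.
rewrite sw_hDelta; try by lin.
transitivity ((f one : k) *: (eps \ox (p.2^-1)%g (\sw_(h1, h2 <- D h) (S h1 ** h2)))).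
  rewrite (lin_sw (f := fun u => (f one : k) *: (eps \ox (p.2^-1)%g u)));
    last by lin.
  apply: eq_sw => h1 h2; congr (_ *: (_ \ox _)).
  rewrite hmulE !S_aut !(aut_xiV A, aut_xiV B, aut_xiV p.1) hopfAutVK.
  rewrite -(aut_umul xiV) hopfAutVK.
  have -> : A (p.1 (S h1)) = (p.2^-1)%g (S h1).
    by rewrite -hopfAut_mulE /A !mulgA mulVg mul1g mulgVK.
  have -> : B = (p.2^-1)%g by rewrite /B !mulgA mulVg mul1g mulgVK.
  by rewrite -aut_umul.
rewrite sw_antipodel lfunZ aut_one (linZ (F := ptens eps)); last by lin.
by rewrite scalerA mulrC.
Qed.

(** Here associativity first groups the two elements of [H], which the antipode
    axiom of [H] collapses; [comul_antipoder] handles the functionals. *)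
Lemma MHD_antipoder p (m : tens dual H) :
  \sw_(h1, h2 <- MHD_Delta p p^-1%g (m : MHD (p * p^-1)%g))
    MHD_mul (p := p) h1 (MHD_S p^-1%g h2 : MHD p^-1^-1%g)
  = MHD_eps H (m : MHD 1%g) *: MHD_one p.
Proof.
have lml := lin_MHD_mull; have lmr := lin_MHD_mulr.
move: m; apply: tens_ext; try by rewrite -/(lin _); lin.
move=> f h; rewrite MHD_DeltaE MHD_epsE sw_sw.
set A := ((p^-1).1 * (p^-1).2)%g; set B := ((p^-1).1^-1 * p.2 * (p^-1).1)%g.
set C := (p^-1)%g.1.
transitivity (\sw_(f1, f2 <- dual_comul f) \sw_(h1, h2 <- hDelta H h)
   MHD_mul (p := p) (f2 \ox hmul (xiV (C h1)) (A (S (xiV (B h2)))))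
     (MHD_xi p (dSV (dxi f1) \ox one))).
  apply: eq_sw => f1 f2; rewrite sw_sw; apply: eq_sw => h1 h2.
  rewrite sw_pure; try by lin.
  rewrite MHD_SE (MHD_mul_eq (invgK p)) -/A.
  have := ha_mulA (MHD_hom_algebra hS_bij p) (dxi f2 \ox xiV (C h1))
           (eps \ox A (S (xiV (B h2)))) (dSV (dxi f1) \ox one).
  rewrite MHD_xiE MHD_mul_lr.
  have -> : dxiV (dxi f2) = f2.
    by apply/lfunP => x; rewrite dual_xiVE dual_xiE hopfAutVK.
  by rewrite -[hxi H (xiV (C h1))]/(xiA H (xiV (C h1))) hopfAutVK => <-.
transitivity (\sw_(f1, f2 <- dual_comul f)
   MHD_mul (p := p) (f2 \ox (eps h *: one)) (MHD_xi p (dSV (dxi f1) \ox one))).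
  apply: eq_sw => f1 f2; rewrite sw_hDelta; try by lin.
  set X := MHD_xi p _.
  transitivity (MHD_mul (p := p)
      (f2 \ox xiV (C (\sw_(h1, h2 <- D h) (h1 ** S h2)))) X); last first.
    by rewrite sw_antipoder !lfunZ !aut_one.
  rewrite (lin_sw (f := fun u => MHD_mul (p := p) (f2 \ox xiV (C u)) X));
    last by lin.
  apply: eq_sw => h1 h2; congr (MHD_mul (_ \ox _) _).
  rewrite hmulE !S_aut !(aut_xiV A, aut_xiV B, aut_xiV C).
  have -> : A (B (S h2)) = C (S h2).
    have e : (p.1^-1 * (p.1 * p.2^-1 * p.1^-1) * (p.1^-1^-1 * p.2 * p.1^-1)
              = p.1^-1)%g.
      by rewrite invgK !mulgA !(mulgVK, mulVg, mul1g).
    by rewrite -hopfAut_mulE [(A * B)%g]e.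
  by rewrite -(aut_umul xiV (xiV (C h1))) hopfAutVK -(aut_umul xiV (C h1))
    -(aut_umul C h1) -[in RHS](aut_xiV C).
transitivity (eps h *: ((f one : k) *: (eps \ox one) : MHD p)).
  rewrite -(comul_antipoder p).
  rewrite (lin_sw (f := fun u : MHD p => eps h *: u)); last by lin.
  apply: eq_sw => f1 f2.
  rewrite (linZ (F := fun u => MHD_mul (p := p) (f2 \ox u) _)) //; lin.
by rewrite scalerA.
Qed.


Lemma MHD_hopf_Tcoalgebra :
  hom_hopf_Tcoalgebra (@MHD_xi k H) (@MHD_mul k H) (@MHD_one k H)
    (@MHD_Delta k H) (@MHD_eps k H) (@MHD_S k H).
Proof.
have linm := @lin_endo k H; have linv := @lin_eval_at k H.
split.
- exact: MHD_Tcoalgebra.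
- exact: MHD_hom_algebra.
- by move=> p q m n; apply: MHD_Delta_mul.
- move=> p q.
  apply: (tmap_jointly_injective (@eval_at_inj k H) (@eval_at_inj k H)).
  move=> x y.
  rewrite eval_Delta tmapE !eval_at_pure endo_pure.
  rewrite (linZ (F := fun u => \sw_(h1, h2 <- D u) (_ \ox _))); last by lin.
  rewrite sw_one; try by lin.
  rewrite !aut_one aut_eps eps_mul.
  rewrite (linZ (F := fun u : H => u \ox _)); last by lin.
  by rewrite (linZ (F := fun u : H => _ \ox u)) ?scalerA 1?mulrC //; lin.
- move=> m n; rewrite !MHD_eps_endo endo_mul // aut_eps /crossed_mul aut_one.
  rewrite sw_one; last 2 first.
  - by move=> u; apply: lin_crossr; lin.
  - by move=> u; apply: (lin_fun (lin_crossl _ _ _ _)); lin.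
  rewrite /cross (lin_sw (f := eps)); last by lin.
  set u := endo m one.
  transitivity (eps (endo n (\sw_(u1, v <- D u) (T v ** u1)))); last first.
    by rewrite sw_Tl // !lfunZ.
  rewrite (lin_sw (f := fun y => eps (endo n y))); last by lin.
  apply: eq_sw => u1 v; rewrite (lin_sw (f := eps)); last by lin.
  rewrite -[RHS](sw_counitl (F := fun v => eps (endo n (T v ** u1))));
    last by lin.
  by apply: eq_sw => u2 u3; rewrite !hopfAut1E umul1r eps_mul.
- by rewrite MHD_eps_endo endo_one /conv_unit lfunZ eps_one [LHS]mulr1.
- move=> p; apply: tens_ext; try by rewrite -/(lin _); lin.
  move=> f h; rewrite MHD_xiE !MHD_SE.
  rewrite (ha_xiM (MHD_hom_algebra hS_bij p^-1%g)) !MHD_xiE dual_xiV_eps.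
  congr (MHD_mul (_ \ox _) (_ \ox _)).
  - change ((p.1 * p.2)%g (S (xiV (xiA H h)))
            = xiA H ((p.1 * p.2)%g (S (xiV h)))).
    by rewrite hopfAutK S_aut aut_xiV hopfAutVK.
  - apply/lfunP => x.
    by rewrite dual_xiVE !dual_SVE !dual_xiE dual_xiVE T_aut // hopfAutVK hopfAutK.
  - by rewrite -[hxi H _]/(xiA H _) aut_one.
- move=> p m; rewrite -MHD_antipodel gcastE; apply: eq_sw => h1 h2.
  by congr (MHD_mul _ _); rewrite gcastE.
- move=> p m; rewrite -MHD_antipoder gcastE; apply: eq_sw => h1 h2.
  by congr (MHD_mul _ _); rewrite gcastE.
Qed.

Lemma MHD_phi_bij q p : bijective (@MHD_phi k H q p).
Proof.
set s := (q.1 * p.1^-1 * q.2^-1 * p.1)%g; set t := (q.2 * q.1^-1)%g.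
have dm (a : hopfAut H) (f : dual) y : dual_map (hopfAut_val a) f y = f (a y).
  exact: dual_mapE.
exists (tmap (dual_map (hopfAut_val (t^-1)%g)) (hopfAut_val (s^-1)%g)) => m;
  apply: endo_inj => x.
  by rewrite (endo_tmap _ _ _ (dm _)) endo_phi hopfAutK hopfAutVK.
by rewrite endo_phi (endo_tmap _ _ _ (dm _)) hopfAutK hopfAutVK.
Qed.

(** [crossed_mul_aut] for the two automorphisms of the conjugation; its side
    conditions are the formula for the conjugate of [p] by [q]. *)
Lemma MHD_phi_morphism q p :
  hom_algebra_morphism (MHD_xi p) (@MHD_mul k H p) (MHD_one p)
    (MHD_xi (q * p * q^-1)%g) (@MHD_mul k H (q * p * q^-1)%g)
    (MHD_one (q * p * q^-1)%g) (MHD_phi q p).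
Proof.
split.
- move=> m; apply: endo_inj => x.
  by rewrite endo_phi !endo_xi endo_phi (aut_xi (_ * _)%g) (aut_xiV (q.2 * q.1^-1)%g).
- move=> m n; apply: endo_inj => x.
  apply: (etrans (endo_phi q (MHD_mul m n) x)).
  apply: (etrans (congr1 _ (endo_mul hS_bij m n _))).
  apply: (etrans _ (esym (endo_mul hS_bij _ _ x))).
  have lE (c : tens dual H) : lin (endo c) by exact: linearP.
  rewrite (crossed_mul_aut hS_bij (a := p.1) (b := p.2) _ (lE m) (lE n)
     (endo_phi q m) (endo_phi q n)).
  + by rewrite aut_xi (aut_xiV (q.2 * q.1^-1)%g).
  + rewrite [(q * p * q^-1)%g.1]/(q.1 * p.1 * q.1^-1)%g !mulgA.
    by rewrite !(mulgK, mulgVK, mulgV, mulVg, mul1g).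
  + rewrite [(q * p * q^-1)%g.2]/(q.1 * q.2^-1 * q.1^-1 * q.1^-1^-1
        * (p.2 * p.1^-1 * q.2 * p.1) * q.1^-1)%g invgK !mulgA.
    by rewrite !(mulgK, mulgVK, mulgV, mulVg, mul1g).
- apply: endo_inj => x; rewrite endo_phi !endo_one /conv_unit lfunZ aut_one.
  by rewrite aut_eps.
Qed.

Lemma MHD_phi_comul r p q (c : tens dual H) :
  MHD_Delta (r * p * r^-1)%g (r * q * r^-1)%g
    (MHD_phi r (p * q)%g c : tens dual H)
  = tmap (MHD_phi r p) (MHD_phi r q) (MHD_Delta p q c).
Proof.
have linm := @lin_endo k H; have linv := @lin_eval_at k H.
apply: (tmap_jointly_injective (@eval_at_inj k H) (@eval_at_inj k H)).
move=> x y.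
set t := (r.2 * r.1^-1)%g.
set sp := (r.1 * p.1^-1 * r.2^-1 * p.1)%g.
set sq := (r.1 * q.1^-1 * r.2^-1 * q.1)%g.
transitivity (\sw_(u, v <- tmap (eval_at (t x)) (eval_at (t y))
                 (MHD_Delta p q c))
   (sp u \ox sq v)); last first.
  rewrite [LHS]sw_tmap; try by lin.
  rewrite [RHS](sw_tmap _ _ _ (F := fun a b => eval_at x a \ox eval_at y b));
    try by lin.
  by apply: eq_sw => a b; rewrite !eval_atE !endo_phi.
rewrite !eval_Delta sw_sw endo_phi sw_aut; try by lin.
rewrite (aut_xi t) (aut_umul t).
apply: eq_sw => a b; rewrite sw_pure; try by lin.
rewrite (aut_xiV sp) (aut_xiV sq); congr (xiV _ \ox xiV _).
- rewrite -!hopfAut_mulE; congr (fun_of_lfun (hopfAut_val _) a).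
  rewrite [(r * q * r^-1)%g.1]/(r.1 * q.1 * r.1^-1)%g.
  rewrite [(p * q)%g.1]/(p.1 * q.1)%g /sp invgM !mulgA.
  by rewrite !(mulgK, mulgVK).
- rewrite -!hopfAut_mulE; congr (fun_of_lfun (hopfAut_val _) b).
  rewrite [(r * q * r^-1)%g.1]/(r.1 * q.1 * r.1^-1)%g.
  rewrite [(r * p * r^-1)%g.2]/(r.1 * r.2^-1 * r.1^-1 * r.1^-1^-1
        * (p.2 * p.1^-1 * r.2 * p.1) * r.1^-1)%g.
  rewrite [(p * q)%g.1]/(p.1 * q.1)%g /sq !(invgM, invgK) !mulgA.
  by rewrite !(mulgK, mulgVK).
Qed.

Lemma MHD_phi_comp q r p (c : tens dual H) :
  (MHD_phi q (r * p * r^-1)%g (MHD_phi r p c) : tens dual H)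
  = MHD_phi (q * r)%g p c.
Proof.
apply: endo_inj => x.
rewrite !endo_phi -!(hopfAut_mulE _ _ x) -!(hopfAut_mulE _ _ (endo c _)).
congr (fun_of_lfun (hopfAut_val _) (endo c (fun_of_lfun (hopfAut_val _) x))).
- rewrite [(r * p * r^-1)%g.1]/(r.1 * p.1 * r.1^-1)%g.
  rewrite [(q * r)%g.1]/(q.1 * r.1)%g.
  rewrite [(q * r)%g.2]/(r.2 * r.1^-1 * q.2 * r.1)%g.
  by rewrite !(invgM, invgK) !mulgA !(mulgK, mulgVK).
- rewrite [(q * r)%g.1]/(q.1 * r.1)%g.
  rewrite [(q * r)%g.2]/(r.2 * r.1^-1 * q.2 * r.1)%g.
  by rewrite invgM !mulgA mulgK.
Qed.
End Crossed.

Theorem theorem3p4 (k : fieldType) (H : homHopf k) (hS_bij : bijective (hS H)) :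
  @crossed_hom_hopf_Tcoalgebra k (mhdG H) (@MHD k H)
    (@MHD_xi k H) (@MHD_mul k H) (@MHD_one k H)
    (@MHD_Delta k H) (@MHD_eps k H) (@MHD_S k H) (@MHD_phi k H).
Proof.
split.
- exact: MHD_hopf_Tcoalgebra.
- exact: MHD_phi_bij.
- by move=> q p; apply: MHD_phi_morphism.
- by move=> r p q c; rewrite gcastE; apply: MHD_phi_comul.
- by move=> r c; rewrite gcastE !MHD_eps_endo endo_phi aut_eps aut_one.
- by move=> q r p c; rewrite gcastE; apply: MHD_phi_comp.
Qed.
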